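(* Let $k$ be a field and let $\mathcal{C}$ and $\mathcal{D}$ be two small $k$-linear categories. Then $\mathcal{C}$ and $\mathcal{D}$ are (left) Morita equivalent if and only if there are a $\mathcal{C}$-$\mathcal{D}$-bimodule $P$ and a $\mathcal{D}$-$\mathcal{C}$-bimodule $Q$ such that $P\otimes_{\mathcal{D}}Q\simeq\mathcal{C}$ and $Q\otimes_{\mathcal{C}}P\simeq\mathcal{D}$ as bimodules. Furthermore, such bimodules satisfy that $\{P_y\}_{y\in\mathcal{D}_0}$ and $\{Q_x\}_{x\in\mathcal{C}_0}$ are sets of projective and finitely generated generators of ${}_{\mathcal{C}}\mathrm{Mod}$ and ${}_{\mathcal{D}}\mathrm{Mod}$ respectively.
   Context: A small category $\mathcal{C}$ with object set $\mathcal{C}_0$ is $k$-linear if each set ${}_y\mathcal{C}_x$ of morphisms from $x$ to $y$ is a $k$-vector space and composition ${}_z\mathcal{C}_y\otimes_k{}_y\mathcal{C}_x\to{}_z\mathcal{C}_x$ is $k$-bilinear. A left $\mathcal{C}$-module is a covariant $k$-linear functor from $\mathcal{C}$ to $k$-vector spaces, i.e. a family $({}_xM)_{x\in\mathcal{C}_0}$ with associative unital actions ${}_y\mathcal{C}_x\otimes_k{}_xM\to{}_yM$; ${}_{\mathcal{C}}\mathrm{Mod}$ is the category of left $\mathcal{C}$-modules. Right modules $(M_x)_x$ are defined analogously with actions $M_x\otimes_k{}_x\mathcal{C}_y\to M_y$. A $\mathcal{C}$-$\mathcal{D}$-bimodule $P$ is a family ${}_xP_y$ ($x\in\mathcal{C}_0$,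 $y\in\mathcal{D}_0$) with compatible left $\mathcal{C}$-action and right $\mathcal{D}$-action; $P_y={}_{-}P_y$ is then a left $\mathcal{C}$-module and ${}_xP={}_xP_{-}$ a right $\mathcal{D}$-module. $\mathcal{C}$ itself is a $\mathcal{C}$-bimodule with components ${}_y\mathcal{C}_x$. Tensor product of a right $\mathcal{C}$-module $M$ and a left $\mathcal{C}$-module $N$: $M\otimes_{\mathcal{C}}N=\big(\bigoplus_{x\in\mathcal{C}_0}M_x\otimes_k{}_xN\big)/\langle mf\otimes n-m\otimes fn\rangle$, over $m\in M_x$, $f\in{}_x\mathcal{C}_y$, $n\in{}_yN$; for bimodules it is taken componentwise, ${}_y(M\otimes_{\mathcal{C}}N)_x={}_yM\otimes_{\mathcal{C}}N_x$. $\mathcal{C}$ and $\mathcal{D}$ are (left) Morita equivalent if ${}_{\mathcal{C}}\mathrm{Mod}$ and ${}_{\mathcal{D}}\mathrm{Mod}$ are equivalent as $k$-linear categories. A set of modules is a set of generators if every module is a quotient of a direct sum of copies of members of the set. *)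

(* Defs.v *)
From HB Require Import structures.
From mathcomp Require Import all_boot all_order all_algebra.
From mathcomp Require Import generic_quotient ring_quotient sesquilinear.
From mathcomp Require Import boolp classical_sets functions cardinality fsbigop.

Set Implicit Arguments.
Unset Strict Implicit.
Unset Printing Implicit Defensive.

Import GRing.Theory.
Local Open Scope classical_set_scope.
Local Open Scope ring_scope.
Local Open Scope quotient_scope.

Section DirectSum.
Variables (k : fieldType) (I : Type) (V : I -> lmodType k).

Record dsum := DSum {
  dsum_val :> forall i, V i;
  dsum_fin : finite_set [set i | dsum_val i <> 0] }.

HB.instance Definition _ := gen_eqMixin dsum.
HB.instance Definition _ := gen_choiceMixin dsum.

Lemma dsumP (u v : dsum) : (forall i, u i = v i) -> u = v.
Proof.
case: u v => [u fu] [v fv] /= uv.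
have {uv}E : u = v by apply: functional_extensionality_dep.
by case: _ / E fv => fv; congr DSum; exact: Prop_irrelevance.
Qed.

Lemma dsum_fin0 : finite_set [set i | (0 : V i) <> 0].
Proof. by apply: (sub_finite_set (B := set0)) => // i /=. Qed.

Lemma dsum_finD (u v : dsum) : finite_set [set i | u i + v i <> 0].
Proof.
apply: (@sub_finite_set _ _ ([set i | u i <> 0] `|` [set i | v i <> 0])).
  move=> i /= uv; have [u0|u0] := pselect (u i = 0); last by left.
  by right=> v0; apply: uv; rewrite u0 v0 addr0.
by rewrite finite_setU; split; exact: dsum_fin.
Qed.

Lemma dsum_finN (u : dsum) : finite_set [set i | - u i <> 0].
Proof.
apply: (sub_finite_set _ (dsum_fin u)) => i /= H E.
by apply: H; rewrite E oppr0.
Qed.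

Lemma dsum_finZ (a : k) (u : dsum) : finite_set [set i | a *: u i <> 0].
Proof.
apply: (sub_finite_set _ (dsum_fin u)) => i /= H E.
by apply: H; rewrite E scaler0.
Qed.

Fact dsum_addA : associative (fun u v => DSum (dsum_finD u v)).
Proof. by move=> u v w; apply: dsumP => i /=; rewrite addrA. Qed.
Fact dsum_addC : commutative (fun u v => DSum (dsum_finD u v)).
Proof. by move=> u v; apply: dsumP => i /=; rewrite addrC. Qed.
Fact dsum_add0 : left_id (DSum dsum_fin0) (fun u v => DSum (dsum_finD u v)).
Proof. by move=> u; apply: dsumP => i /=; rewrite add0r. Qed.
Fact dsum_addN : left_inverse (DSum dsum_fin0) (fun u => DSum (dsum_finN u))
  (fun u v => DSum (dsum_finD u v)).
Proof. by move=> u; apply: dsumP => i /=; rewrite addNr. Qed.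
HB.instance Definition _ :=
  GRing.isZmodule.Build dsum dsum_addA dsum_addC dsum_add0 dsum_addN.

Fact dsum_scaleA a b (u : dsum) :
  DSum (dsum_finZ a (DSum (dsum_finZ b u))) = DSum (dsum_finZ (a * b) u).
Proof. by apply: dsumP => i /=; rewrite scalerA. Qed.
Fact dsum_scale1 : left_id 1 (fun a u => DSum (dsum_finZ a u)).
Proof. by move=> u; apply: dsumP => i /=; rewrite scale1r. Qed.
Fact dsum_scaleDr : right_distributive (fun a u => DSum (dsum_finZ a u)) +%R.
Proof. by move=> a u v; apply: dsumP => i /=; rewrite scalerDr. Qed.
Fact dsum_scaleDl u : {morph (fun a => DSum (dsum_finZ a u)) : a b / a + b}.
Proof. by move=> a b; apply: dsumP => i /=; rewrite scalerDl. Qed.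
HB.instance Definition _ := GRing.Zmodule_isLmodule.Build k dsum
  dsum_scaleA dsum_scale1 dsum_scaleDr dsum_scaleDl.

Lemma dsumDE (u v : dsum) i : (u + v) i = u i + v i. Proof. by []. Qed.
Lemma dsumZE a (u : dsum) i : (a *: u) i = a *: u i. Proof. by []. Qed.
Lemma dsum0E i : (0 : dsum) i = 0. Proof. by []. Qed.

(* [dfwith] needs decidable equality on I, provided classically by [{classic I}]. *)
Definition dsum_single (i : I) (v : V i) : forall j, V j :=
  @dfwith {classic I} V (fun=> 0) i v.

Lemma dsum_in_fin i (v : V i) : finite_set [set j | dsum_single v j <> 0].
Proof.
apply: (@sub_finite_set {classic I} _ [set (i : {classic I})]); last exact: finite_set1.
move=> j /=; rewrite /dsum_single.
by case: (@dfwithP {classic I} V (fun=> 0) i v j).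
Qed.

Definition dsum_in i (v : V i) : dsum := DSum (dsum_in_fin v).

Lemma dsum_in_linear i : linear (@dsum_in i).
Proof.
move=> a u v; apply: dsumP => j; rewrite dsumDE dsumZE /= /dsum_single.
have [E|nE] := pselect (i = j).
  by case: _ / E; rewrite !(@dfwith_in {classic I} V).
have nE' : (i : {classic I}) != j by apply/eqP.
by rewrite !(@dfwith_out {classic I} V) // scaler0 addr0.
Qed.
HB.instance Definition _ i :=
  GRing.isLinear.Build k (V i) dsum *:%R (@dsum_in i) (@dsum_in_linear i).

Section Lift.
Variables (W : lmodType k) (f : forall i, V i -> W).

Definition dsum_lift (u : dsum) : W :=
  \sum_(i \in [set: {classic I}]) @f i (u i).

Hypothesis f_linear : forall i, linear (@f i).

Lemma dsum_lift_f0 i : @f i 0 = 0.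
Proof. by have := @f_linear i (-1) 0 0; rewrite scaler0 addr0 scaleN1r addNr. Qed.

Lemma dsum_liftE (u : dsum) (A : set {classic I}) : finite_set A ->
  [set i | u i <> 0] `<=` A -> dsum_lift u = \sum_(i \in A) @f i (u i).
Proof.
move=> fA uA; apply: esym; apply: fsbig_widen => // i [_ /= nA].
have -> : u i = 0 by apply/not_notP => u0; apply: nA; exact: uA.
exact: dsum_lift_f0.
Qed.

Lemma dsum_lift_linear : linear dsum_lift.
Proof.
move=> a u v; pose A : set {classic I} := [set i | u i <> 0] `|` [set i | v i <> 0].
have fA : finite_set A by rewrite finite_setU; split; exact: dsum_fin.
rewrite (dsum_liftE (u := u) fA); last by move=> i; left.
rewrite (dsum_liftE (u := v) fA); last by move=> i; right.
rewrite (dsum_liftE (A := A) fA); last first.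
  move=> i /= uv; have [u0|u0] := pselect (u i = 0); last by left.
  by right=> v0; apply: uv; rewrite u0 v0 scaler0 addr0.
rewrite !fsbig_finite //= scaler_sumr -big_split /=.
by apply: eq_bigr => i _; rewrite f_linear.
Qed.

Lemma dsum_lift_in i (v : V i) : dsum_lift (dsum_in v) = @f i v.
Proof.
rewrite (@dsum_liftE _ [set (i : {classic I})]); first 1 last.
- exact: finite_set1.
- move=> j /=; rewrite /dsum_single.
  by case: (@dfwithP {classic I} V (fun=> 0) i v j).
by rewrite fsbig_set1 /= /dsum_single (@dfwith_in {classic I} V).
Qed.

End Lift.

Lemma dsum_sumE (u : dsum) :
  u = \sum_(i \in [set: {classic I}]) dsum_in (u i).
Proof.
pose A : set {classic I} := [set i | u i <> 0].
have fA : finite_set A by exact: dsum_fin.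
rewrite -/(dsum_lift dsum_in u) (dsum_liftE dsum_in_linear fA) //.
rewrite fsbig_finite //=; apply: dsumP => j.
have ev (s : seq {classic I}) (F : {classic I} -> dsum) :
  (\sum_(i <- s) F i) j = \sum_(i <- s) F i j.
  by elim: s => [|i s IH]; rewrite ?big_nil // !big_cons dsumDE IH.
rewrite ev; have [Aj|nAj] := pselect (A j); last first.
  have uj0 : u j = 0 by apply/not_notP.
  rewrite big1_seq // => i /andP[_ iA] /=; rewrite /dsum_single dfwith_out //.
  apply/eqP => E; move: iA; rewrite in_fset_set // inE => Ai; apply: nAj.
  by rewrite -E.
rewrite (bigD1_seq (j : {classic I})) /=; last 2 first.
- by rewrite in_fset_set // inE.
- exact: finmap.fset_uniq.
rewrite {1}/dsum_single dfwith_in big1 ?addr0 // => i ij.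
by rewrite /dsum_single dfwith_out.
Qed.

End DirectSum.

Lemma dsum_ext (k : fieldType) (I : Type) (V : I -> lmodType k)
    (W : lmodType k) (f g : dsum V -> W) : linear f -> linear g ->
  (forall i (v : V i), f (dsum_in v) = g (dsum_in v)) -> f =1 g.
Proof.
move=> lf lg fg u.
pose F := GRing.isLinear.Build k _ W *:%R f lf.
pose f' : {linear dsum V -> W} := HB.pack f F.
pose G := GRing.isLinear.Build k _ W *:%R g lg.
pose g' : {linear dsum V -> W} := HB.pack g G.
have: f' u = g' u; last by [].
have fin : finite_set [set i : {classic I} | u i <> 0] by exact: dsum_fin.
have -> : u = \sum_(i <- finmap.enum_fset (fset_set [set i : {classic I} | u i <> 0]))
                dsum_in (u i).
  rewrite {1}(dsum_sumE u) -fsbig_finite //.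
  by apply: (dsum_liftE (@dsum_in_linear _ _ V)).
by rewrite !linear_sum; apply: eq_bigr => i _; exact: fg.
Qed.

Section Quotient.
Variables (k : fieldType) (V : lmodType k) (S : set V).

Definition lspan : {pred V} :=
  [pred v | `[< forall U : {pred V}, submod_closed U ->
                  (forall s, S s -> s \in U) -> v \in U >]].

Lemma lspanP v : reflect (forall U : {pred V}, submod_closed U ->
                  (forall s, S s -> s \in U) -> v \in U) (v \in lspan).
Proof. exact: asboolP. Qed.

Fact lspan_closed : submod_closed lspan.
Proof.
split=> [|a u v /lspanP Su /lspanP Sv]; apply/lspanP => U cU SU.
  by case: cU.
by case: (cU) => _; apply; [exact: Su | exact: Sv].
Qed.
HB.instance Definition _ := GRing.isSubmodClosed.Build k V lspan lspan_closed.

Lemma mem_lspan s : S s -> s \in lspan.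
Proof. by move=> Ss; apply/lspanP => U _; apply. Qed.

(* V / span S. *)
Definition quo : Type := Quotient.quot lspan.
HB.instance Definition _ := GRing.Zmodule.on quo.

Definition quo_pi (v : V) : quo := \pi_(Quotient.quot lspan) v.

Lemma quo_piE u v : quo_pi u = quo_pi v <-> u - v \in lspan.
Proof. by rewrite /quo_pi Quotient.idealrBE; split=> [uv|/eqP //]; apply/eqP. Qed.

Lemma quo_reprK (q : quo) : quo_pi (repr q) = q.
Proof. exact: reprK. Qed.

Lemma quo_piB : {morph quo_pi : u v / u - v}.
Proof. by move=> u v; rewrite /quo_pi !piE. Qed.
Lemma quo_piD : {morph quo_pi : u v / u + v}.
Proof. by move=> u v; rewrite /quo_pi !piE. Qed.

Definition quo_scale (a : k) (q : quo) : quo := quo_pi (a *: repr q).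

Lemma quo_scale_pi a v : quo_scale a (quo_pi v) = quo_pi (a *: v).
Proof.
apply/quo_piE; rewrite -scalerBr rpredZ //.
by apply/quo_piE; rewrite quo_reprK.
Qed.

Fact quo_scaleA a b q : quo_scale a (quo_scale b q) = quo_scale (a * b) q.
Proof. by rewrite -[q]quo_reprK !quo_scale_pi scalerA. Qed.
Fact quo_scale1 : left_id 1 quo_scale.
Proof. by move=> q; rewrite -[q]quo_reprK quo_scale_pi scale1r. Qed.
Fact quo_scaleDr : right_distributive quo_scale +%R.
Proof.
move=> a p q; rewrite -[p]quo_reprK -[q]quo_reprK -quo_piD !quo_scale_pi.
by rewrite scalerDr quo_piD.
Qed.
Fact quo_scaleDl q : {morph quo_scale^~ q : a b / a + b}.
Proof.
by move=> a b; rewrite -[q]quo_reprK !quo_scale_pi scalerDl quo_piD.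
Qed.
HB.instance Definition _ := GRing.Zmodule_isLmodule.Build k quo
  quo_scaleA quo_scale1 quo_scaleDr quo_scaleDl.

Fact quo_pi_linear : linear quo_pi.
Proof. by move=> a u v; rewrite quo_piD -quo_scale_pi. Qed.
HB.instance Definition _ :=
  GRing.isLinear.Build k V quo *:%R quo_pi quo_pi_linear.

Lemma quo_pi0 s : S s -> quo_pi s = 0.
Proof. by move=> Ss; rewrite -(linear0 quo_pi); apply/quo_piE; rewrite subr0 mem_lspan. Qed.

Section Lift.
Variables (W : lmodType k) (f : V -> W).

(* Depends only on the class of the representative when f is linear and
   vanishes on S. *)
Definition quo_lift (q : quo) : W := f (repr q).

Hypotheses (f_linear : linear f) (f0 : forall s, S s -> f s = 0).

Lemma quo_lift_pi v : quo_lift (quo_pi v) = f v.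
Proof.
have : repr (quo_pi v) - v \in lspan by apply/quo_piE; rewrite quo_reprK.
move/lspanP => /(_ [pred u | f u == 0]) H.
have fz : f 0 = 0.
  by have := f_linear (-1) 0 0; rewrite scaler0 addr0 scaleN1r addNr.
have : repr (quo_pi v) - v \in [pred u | f u == 0].
  apply: H => [|s Ss]; last by rewrite inE; apply/eqP; exact: f0.
  split=> [|a u w]; rewrite !inE ?fz // => /eqP u0 /eqP w0.
  by rewrite f_linear u0 w0 scaler0 addr0.
rewrite inE addrC -scaleN1r f_linear scaleN1r addrC subr_eq0 => /eqP.
by rewrite /quo_lift.
Qed.

Lemma quo_lift_linear : linear quo_lift.
Proof.
move=> a p q; rewrite -[p]quo_reprK -[q]quo_reprK -linearP !quo_lift_pi.
exact: f_linear.
Qed.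

End Lift.
End Quotient.

Section TensorK.
Variables (k : fieldType) (V W : lmodType k).

Definition freemod (T : Type) : lmodType k := dsum (fun _ : T => (k^o : lmodType k)).
Definition delta (T : Type) (t : T) : freemod T :=
  @dsum_in k T (fun=> (k^o : lmodType k)) t 1.

Definition tensk_rel : set (freemod (V * W)) := [set u |
  (exists a v v' w,
     u = delta (a *: v + v', w) - (a *: delta (v, w) + delta (v', w))) \/
  (exists a v w w',
     u = delta (v, a *: w + w') - (a *: delta (v, w) + delta (v, w')))].

Definition tensk : lmodType k := quo tensk_rel.

Definition pure (v : V) (w : W) : tensk := quo_pi tensk_rel (delta (v, w)).

Lemma pure_bilinear : bilinear_for *:%R *:%R pure.
Proof.
split=> [w a v v'|v a w w'] /=; rewrite /pure -linearP;
  apply/eqP; rewrite -subr_eq0 -linearB; apply/eqP; apply: quo_pi0.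
  by left; exists a, v, v', w.
by right; exists a, v, w, w'.
Qed.

Section Lift.
Variables (U : lmodType k) (f : V -> W -> U).

Definition freelift (u : freemod (V * W)) : U :=
  dsum_lift (fun (t : V * W) (c : k^o) => (c : k) *: f t.1 t.2) u.

Definition tensk_lift : tensk -> U := quo_lift freelift.

Hypothesis f_bilinear : bilinear_for *:%R *:%R f.

Lemma freelift_linear : linear freelift.
Proof.
by apply: dsum_lift_linear => t a c c'; rewrite scalerDl scalerA.
Qed.

Lemma freelift_delta v w : freelift (delta (v, w)) = f v w.
Proof.
rewrite /freelift dsum_lift_in ?scale1r //.
by move=> t a c c'; rewrite scalerDl scalerA.
Qed.

Lemma freelift_rel u : tensk_rel u -> freelift u = 0.
Proof.
have lin := freelift_linear.
have linB p q : freelift (p - q) = freelift p - freelift q.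
  by rewrite addrC -scaleN1r lin scaleN1r addrC.
case=> [[a [v [v' [w ->]]]]|[a [v [w [w' ->]]]]];
  rewrite linB lin !freelift_delta.
  by rewrite f_bilinear.1 subrr.
by rewrite f_bilinear.2 subrr.
Qed.

Lemma tensk_lift_linear : linear tensk_lift.
Proof. exact: quo_lift_linear freelift_linear freelift_rel. Qed.

Lemma tensk_lift_pure v w : tensk_lift (pure v w) = f v w.
Proof.
by rewrite /tensk_lift quo_lift_pi ?freelift_delta //;
   [exact: freelift_linear | exact: freelift_rel].
Qed.

End Lift.

Lemma tensk_ext (U : lmodType k) (f g : tensk -> U) : linear f -> linear g ->
  (forall v w, f (pure v w) = g (pure v w)) -> f =1 g.
Proof.
move=> lf lg fg q; rewrite -[q]quo_reprK.
have lpi (h : tensk -> U) : linear h -> linear (h \o quo_pi tensk_rel).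
  by move=> lh a u v /=; rewrite linearP lh.
move: (repr q); apply: (dsum_ext (lpi f lf) (lpi g lg)) => -[v w] c /=.
have -> : dsum_in (V := fun=> k^o) (i := (v, w)) c = c *: delta (v, w).
  by rewrite /delta -linearZ /= /GRing.scale /= mulr1.
have lz (h : tensk -> U) : linear h -> forall q', h (c *: q') = c *: h q'.
  move=> lh q'; have h0 : h 0 = 0.
    by have := lh (-1) 0 0; rewrite scaler0 addr0 scaleN1r addNr.
  by have := lh c q' 0; rewrite !addr0 h0 addr0.
by rewrite linearZ /= !lz // fg.
Qed.

End TensorK.

(* [hom y x] is the space of morphisms from x to y, so that [cmp g f] is
   "g after f". *)
Record lincat (k : fieldType) := LinCat {
  obj :> Type;
  hom : obj -> obj -> lmodType k;
  idm : forall x, hom x x;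
  cmp : forall z y x, hom z y -> hom y x -> hom z x;
  cmp_bilinear : forall z y x, bilinear_for *:%R *:%R (@cmp z y x);
  cmpA : forall t z y x (h : hom t z) (g : hom z y) (f : hom y x),
    cmp h (cmp g f) = cmp (cmp h g) f;
  cmp1m : forall y x (f : hom y x), cmp (idm y) f = f;
  cmpm1 : forall y x (f : hom y x), cmp f (idm x) = f }.

Arguments hom {k C} y x : rename.
Arguments idm {k C} x : rename.
Arguments cmp {k C z y x} g f : rename.

Record leftmod (k : fieldType) (C : lincat k) := LeftMod {
  lcar :> C -> lmodType k;
  lact : forall y x, hom y x -> lcar x -> lcar y;
  lact_bilinear : forall y x, bilinear_for *:%R *:%R (@lact y x);
  lactA : forall z y x (g : hom z y) (f : hom y x) m,
    lact g (lact f m) = lact (cmp g f) m;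
  lact1 : forall x m, lact (idm x) m = m }.

Arguments lact {k C M y x} f m : rename.

Record rightmod (k : fieldType) (C : lincat k) := RightMod {
  rcar :> C -> lmodType k;
  ract : forall x y, rcar x -> hom x y -> rcar y;
  ract_bilinear : forall x y, bilinear_for *:%R *:%R (@ract x y);
  ractA : forall x y z m (f : hom x y) (g : hom y z),
    ract (ract m f) g = ract m (cmp f g);
  ract1 : forall x m, ract m (idm x) = m }.

Arguments ract {k C M x y} m f : rename.

Record bimod (k : fieldType) (C D : lincat k) := BiMod {
  bcar :> C -> D -> lmodType k;
  blact : forall x' x y, hom x' x -> bcar x y -> bcar x' y;
  bract : forall x y y', bcar x y -> hom y y' -> bcar x y';
  blact_bilinear : forall x' x y, bilinear_for *:%R *:%R (@blact x' x y);
  blactA : forall x'' x' x y (g : hom x'' x') (f : hom x' x) (p : bcar x y),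
    blact g (blact f p) = blact (cmp g f) p;
  blact1 : forall x y (p : bcar x y), blact (idm x) p = p;
  bract_bilinear : forall x y y', bilinear_for *:%R *:%R (@bract x y y');
  bractA : forall x y y' y'' (p : bcar x y) (f : hom y y') (g : hom y' y''),
    bract (bract p f) g = bract p (cmp f g);
  bract1 : forall x y (p : bcar x y), bract p (idm y) = p;
  blractA : forall x' x y y' (f : hom x' x) (p : bcar x y) (g : hom y y'),
    bract (blact f p) g = blact f (bract p g) }.

Arguments blact {k C D P x' x y} f p : rename.
Arguments bract {k C D P x y y'} p g : rename.

Section Bimodules.
Variables (k : fieldType) (C D : lincat k).

(* The left C-module P_y and, below, the right D-module _xP. *)
Definition bcol (P : bimod C D) (y : D) : leftmod C :=
  @LeftMod k C (fun x => P x y) (fun x' x f p => blact f p)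
    (fun x' x => blact_bilinear P x' x y)
    (fun x'' x' x g f p => blactA g f p) (fun x p => blact1 p).

Definition brow (P : bimod C D) (x : C) : rightmod D :=
  @RightMod k D (P x) (fun y y' p g => bract p g)
    (fun y y' => bract_bilinear P x y y')
    (fun y y' y'' p f g => bractA p f g) (fun y p => bract1 p).

Definition regular : bimod C C :=
  @BiMod k C C (fun y x => hom y x)
    (fun x' x y f p => cmp f p) (fun x y y' p g => cmp p g)
    (fun x' x y => cmp_bilinear (l := C) x' x y)
    (fun x'' x' x y g f p => cmpA g f p) (fun x y p => cmp1m p)
    (fun x y y' => cmp_bilinear (l := C) x y y')
    (fun x y y' y'' p f g => esym (cmpA p f g)) (fun x y p => cmpm1 p)
    (fun x' x y y' f p g => esym (cmpA f p g)).

Record bihom (P Q : bimod C D) := BiHom {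
  bfun :> forall x y, P x y -> Q x y;
  bfun_linear : forall x y, linear (@bfun x y);
  bfun_lact : forall x' x y (f : hom x' x) (p : P x y),
    bfun (blact f p) = blact f (bfun p);
  bfun_ract : forall x y y' (p : P x y) (g : hom y y'),
    bfun (bract p g) = bract (bfun p) g }.

Definition bimod_iso (P Q : bimod C D) : Prop :=
  exists (f : bihom P Q) (g : bihom Q P),
    forall x y, cancel (@bfun _ _ f x y) (@bfun _ _ g x y) /\
                cancel (@bfun _ _ g x y) (@bfun _ _ f x y).

End Bimodules.

Section Tensor.
Variables (k : fieldType) (C : lincat k) (M : rightmod C) (N : leftmod C).

Definition tens_sum : lmodType k := dsum (fun x : C => tensk (M x) (N x)).

Definition tens_in (x : C) (t : tensk (M x) (N x)) : tens_sum :=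
  @dsum_in k C (fun x => tensk (M x) (N x)) x t.

Definition tens_rel : set tens_sum := [set u |
  exists (x y : C) (m : M x) (f : hom x y) (n : N y),
    u = tens_in (pure (ract m f) n) - tens_in (pure m (lact f n))].

Definition tens : lmodType k := quo tens_rel.

Definition tpure (x : C) (m : M x) (n : N x) : tens :=
  quo_pi tens_rel (tens_in (pure m n)).

Lemma tpure_bilinear x : bilinear_for *:%R *:%R (@tpure x).
Proof.
have lin : linear (fun t : tensk (M x) (N x) => quo_pi tens_rel (tens_in t)).
  by move=> a u v; rewrite /tens_in !linearP.
split=> [n a m m'|m a n n'] /=; rewrite /tpure -[RHS]lin;
  congr (quo_pi _ (tens_in _)).
  exact: (pure_bilinear (M x) (N x)).1.
exact: (pure_bilinear (M x) (N x)).2.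
Qed.

Lemma tpure_balanced x y (m : M x) (f : hom x y) (n : N y) :
  tpure (ract m f) n = tpure m (lact f n).
Proof.
apply/eqP; rewrite -subr_eq0 -linearB; apply/eqP; apply: quo_pi0.
by exists x, y, m, f, n.
Qed.

Section Lift.
Variables (U : lmodType k) (f : forall x, M x -> N x -> U).

Definition tens_lift : tens -> U :=
  quo_lift (dsum_lift (fun x => tensk_lift (@f x))).

Hypothesis f_bilinear : forall x, bilinear_for *:%R *:%R (@f x).
Hypothesis f_balanced : forall x y (m : M x) (g : hom x y) (n : N y),
  f (ract m g) n = f m (lact g n).

Let F := dsum_lift (fun x => tensk_lift (@f x)).
Let F_linear : linear F.
Proof. by apply: dsum_lift_linear => x; exact: tensk_lift_linear. Qed.
Let F_in x (t : tensk (M x) (N x)) : F (tens_in t) = tensk_lift (@f x) t.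
Proof. by rewrite /F /tens_in dsum_lift_in // => y; exact: tensk_lift_linear. Qed.
Let F_rel u : tens_rel u -> F u = 0.
Proof.
move=> [x [y [m [g [n ->]]]]].
rewrite addrC -scaleN1r F_linear scaleN1r !F_in.
by rewrite !tensk_lift_pure // f_balanced addNr.
Qed.

Lemma tens_lift_linear : linear tens_lift.
Proof. exact: quo_lift_linear F_linear F_rel. Qed.

Lemma tens_lift_pure x (m : M x) (n : N x) : tens_lift (tpure m n) = f m n.
Proof.
by rewrite /tens_lift /tpure (quo_lift_pi F_linear F_rel) F_in tensk_lift_pure.
Qed.

End Lift.

Lemma tens_ext (U : lmodType k) (f g : tens -> U) : linear f -> linear g ->
  (forall x (m : M x) (n : N x), f (tpure m n) = g (tpure m n)) -> f =1 g.
Proof.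
move=> lf lg fg q; rewrite -[q]quo_reprK.
have lpi (h : tens -> U) : linear h -> linear (h \o quo_pi tens_rel).
  by move=> lh a u v /=; rewrite linearP lh.
move: (repr q); apply: (dsum_ext (lpi f lf) (lpi g lg)) => x t /=.
have lin (h : tens -> U) : linear h ->
    linear (fun t : tensk (M x) (N x) => h (quo_pi tens_rel (tens_in t))).
  by move=> lh a u v; rewrite /tens_in !linearP lh.
by move: t; apply: (tensk_ext (lin f lf) (lin g lg)) => m n; exact: fg.
Qed.

End Tensor.

Section BimoduleTensor.
Variables (k : fieldType) (C D E : lincat k) (P : bimod C D) (Q : bimod D E).

Definition btens_car (x : C) (z : E) : lmodType k := tens (brow P x) (bcol Q z).

Definition btens_pure x z (y : D) (p : P x y) (q : Q y z) : btens_car x z :=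
  @tpure k D (brow P x) (bcol Q z) y p q.

Definition btens_lact (x' x : C) (z : E) (f : hom x' x) :
    btens_car x z -> btens_car x' z :=
  @tens_lift k D (brow P x) (bcol Q z) (btens_car x' z)
    (fun y (p : P x y) (q : Q y z) => btens_pure (blact f p) q).

Definition btens_ract (x : C) (z z' : E) (t : btens_car x z) (g : hom z z') :
    btens_car x z' :=
  @tens_lift k D (brow P x) (bcol Q z) (btens_car x z')
    (fun y (p : P x y) (q : Q y z) => btens_pure p (bract q g)) t.

Let pureL x z (y : D) (q : Q y z) : linear (fun p : P x y => btens_pure p q).
Proof. exact: (tpure_bilinear (brow P x) (bcol Q z) y).1. Qed.
Let pureR x z (y : D) (p : P x y) : linear (fun q : Q y z => btens_pure p q).
Proof. exact: (tpure_bilinear (brow P x) (bcol Q z) y).2. Qed.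
Let balanced x z (y y' : D) (p : P x y) (g : hom y y') (q : Q y' z) :
  btens_pure (bract p g) q = btens_pure p (blact g q).
Proof. exact: (@tpure_balanced _ _ (brow P x) (bcol Q z)). Qed.

Let lbil x' x z (f : hom x' x) y : bilinear_for *:%R *:%R
  (fun (p : brow P x y) (q : bcol Q z y) => btens_pure (blact f p) q).
Proof.
split=> [q a p p'|p a q q'] /=; last exact: pureR.
by rewrite (blact_bilinear P x' x y).2 pureL.
Qed.
Let lbal x' x z (f : hom x' x) y y' (p : brow P x y) (g : hom y y')
    (q : bcol Q z y') :
  btens_pure (blact f (ract p g : P x y')) q =
  btens_pure (blact f p) (lact g q : Q y z).
Proof. by rewrite /= -blractA balanced. Qed.

Let rbil x z z' (g : hom z z') y : bilinear_for *:%R *:%R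
  (fun (p : brow P x y) (q : bcol Q z y) => btens_pure p (bract q g)).
Proof.
split=> [q a p p'|p a q q'] /=; first exact: pureL.
by rewrite (bract_bilinear Q y z z').1 pureR.
Qed.
Let rbal x z z' (g : hom z z') y y' (p : brow P x y) (f : hom y y')
    (q : bcol Q z y') :
  btens_pure (ract p f : P x y') (bract q g) =
  btens_pure p (bract (lact f q : Q y z) g).
Proof. by rewrite /= balanced blractA. Qed.

Lemma btens_lact_linear x' x z (f : hom x' x) : linear (@btens_lact x' x z f).
Proof. exact: (@tens_lift_linear k D (brow P x) (bcol Q z) _ _
  (@lbil x' x z f) (@lbal x' x z f)). Qed.
Lemma btens_ract_linear x z z' (g : hom z z') :
  linear (fun t : btens_car x z => btens_ract t g).
Proof. exact: (@tens_lift_linear k D (brow P x) (bcol Q z) _ _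
  (@rbil x z z' g) (@rbal x z z' g)). Qed.

Lemma btens_lact_pure x' x z (f : hom x' x) y (p : P x y) (q : Q y z) :
  btens_lact f (btens_pure p q) = btens_pure (blact f p) q.
Proof. exact: (@tens_lift_pure k D (brow P x) (bcol Q z) _ _
  (@lbil x' x z f) (@lbal x' x z f)). Qed.
Lemma btens_ract_pure x z z' (g : hom z z') y (p : P x y) (q : Q y z) :
  btens_ract (btens_pure p q) g = btens_pure p (bract q g).
Proof. exact: (@tens_lift_pure k D (brow P x) (bcol Q z) _ _
  (@rbil x z z' g) (@rbal x z z' g)). Qed.

Lemma btens_ext x z (U : lmodType k) (f g : btens_car x z -> U) :
  linear f -> linear g ->
  (forall y (p : P x y) (q : Q y z), f (btens_pure p q) = g (btens_pure p q)) ->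
  f =1 g.
Proof. exact: tens_ext. Qed.

Let lincomb (U V : lmodType k) (f g : U -> V) a : linear f -> linear g ->
  linear (fun t => a *: f t + g t).
Proof.
move=> lf lg b u v; rewrite lf lg !scalerDr !scalerA addrACA.
by rewrite (mulrC a b).
Qed.

Fact btens_lact_bilinear x' x z :
  bilinear_for *:%R *:%R (@btens_lact x' x z).
Proof.
split=> [t a f g|f]; last exact: btens_lact_linear.
apply: (btens_ext (f := btens_lact _) (g := fun t => a *: btens_lact f t + btens_lact g t)).
- exact: btens_lact_linear.
- by apply: lincomb; exact: btens_lact_linear.
move=> y p q; rewrite !btens_lact_pure.
by rewrite (blact_bilinear P x' x y).1 pureL.
Qed.

Fact btens_ract_bilinear x z z' :
  bilinear_for *:%R *:%R (@btens_ract x z z').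
Proof.
split=> [g|t a f g]; first exact: btens_ract_linear.
apply: (btens_ext (f := fun t => btens_ract t _)
  (g := fun t => a *: btens_ract t f + btens_ract t g)).
- exact: btens_ract_linear.
- by apply: lincomb; exact: btens_ract_linear.
move=> y p q; rewrite !btens_ract_pure.
by rewrite (bract_bilinear Q y z z').2 pureR.
Qed.

Let lincomp (U V W : lmodType k) (f : V -> W) (g : U -> V) :
  linear f -> linear g -> linear (fun t => f (g t)).
Proof. by move=> lf lg b u v; rewrite lg lf. Qed.

Fact btens_lactA x'' x' x z (g : hom x'' x') (f : hom x' x) (t : btens_car x z) :
  btens_lact g (btens_lact f t) = btens_lact (cmp g f) t.
Proof.
move: t; apply: (btens_ext (f := fun t => btens_lact g (btens_lact f t))).
- by apply: lincomp; exact: btens_lact_linear.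
- exact: btens_lact_linear.
by move=> y p q; rewrite !btens_lact_pure blactA.
Qed.

Fact btens_lact1 x z (t : btens_car x z) : btens_lact (idm x) t = t.
Proof.
move: t; apply: (btens_ext (f := btens_lact _) (g := id)) => //.
  exact: btens_lact_linear.
by move=> y p q; rewrite btens_lact_pure blact1.
Qed.

Fact btens_ractA x z z' z'' (t : btens_car x z) (f : hom z z') (g : hom z' z'') :
  btens_ract (btens_ract t f) g = btens_ract t (cmp f g).
Proof.
move: t; apply: (btens_ext (f := fun t => btens_ract (btens_ract t f) g)
  (g := fun t => btens_ract t _)).
- by apply: (lincomp (f := fun t => btens_ract t g)); exact: btens_ract_linear.
- exact: btens_ract_linear.
by move=> y p q; rewrite !btens_ract_pure bractA.
Qed.

Fact btens_ract1 x z (t : btens_car x z) : btens_ract t (idm z) = t.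
Proof.
move: t; apply: (btens_ext (f := fun t => btens_ract t _) (g := id)) => //.
  exact: btens_ract_linear.
by move=> y p q; rewrite btens_ract_pure bract1.
Qed.

Fact btens_lractA x' x z z' (f : hom x' x) (t : btens_car x z) (g : hom z z') :
  btens_ract (btens_lact f t) g = btens_lact f (btens_ract t g).
Proof.
move: t; apply: (btens_ext (f := fun t => btens_ract (btens_lact f t) g)
  (g := fun t => btens_lact f (btens_ract t g))).
- apply: (lincomp (f := fun t => btens_ract t g)).
    exact: btens_ract_linear.
  exact: btens_lact_linear.
- apply: (lincomp (g := fun t => btens_ract t g)).
    exact: btens_lact_linear.
  exact: btens_ract_linear.
by move=> y p q; rewrite !(btens_lact_pure, btens_ract_pure).
Qed.

Definition btens : bimod C E :=
  @BiMod k C E btens_car btens_lact btens_ract btens_lact_bilinear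
    btens_lactA btens_lact1 btens_ract_bilinear btens_ractA btens_ract1
    btens_lractA.

End BimoduleTensor.

Section ModuleCategory.
Variables (k : fieldType) (C : lincat k).

Record lhom (M N : leftmod C) := LHom {
  lfun :> forall x, M x -> N x;
  lfun_linear : forall x, linear (@lfun x);
  lfun_act : forall y x (f : hom y x) (m : M x),
    lfun (lact f m) = lact f (lfun m) }.

HB.instance Definition _ M N := gen_eqMixin (lhom M N).
HB.instance Definition _ M N := gen_choiceMixin (lhom M N).

Lemma lhomP (M N : leftmod C) (f g : lhom M N) :
  (forall x (m : M x), f x m = g x m) -> f = g.
Proof.
case: f g => [f f1 f2] [g g1 g2] /= fg.
have E : f = g by apply: functional_extensionality_dep => x; apply/funext => m.
by case: _ / E g1 g2 => g1 g2; congr LHom; exact: Prop_irrelevance.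
Qed.

HB.instance Definition _ M N (f : lhom M N) x :=
  GRing.isLinear.Build k (M x) (N x) *:%R (@lfun M N f x) (@lfun_linear M N f x).
HB.instance Definition _ (M : leftmod C) y x (f : hom y x) :=
  GRing.isLinear.Build k (M x) (M y) *:%R (@lact k C M y x f)
    ((lact_bilinear M y x).2 f).

Section HomSpace.
Variables M N : leftmod C.
Implicit Types f g : lhom M N.

Fact lhom0_linear x : linear (fun _ : M x => 0 : N x).
Proof. by move=> a u v; rewrite scaler0 addr0. Qed.
Fact lhom0_act y x (h : hom y x) (m : M x) : (0 : N y) = lact h (0 : N x).
Proof. by rewrite linear0. Qed.
Definition lhom0 : lhom M N := LHom lhom0_linear lhom0_act.

Fact lhomN_linear f x : linear (fun m : M x => - f x m).
Proof. by move=> a u v; rewrite linearP opprD scalerN. Qed.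
Fact lhomN_act f y x (h : hom y x) (m : M x) :
  - f y (lact h m) = lact h (- f x m).
Proof. by rewrite lfun_act linearN. Qed.
Definition lhomN f : lhom M N := LHom (lhomN_linear f) (lhomN_act f).

Fact lhomD_linear f g x : linear (fun m : M x => f x m + g x m).
Proof. by move=> a u v; rewrite !linearP addrACA scalerDr. Qed.
Fact lhomD_act f g y x (h : hom y x) (m : M x) :
  f y (lact h m) + g y (lact h m) = lact h (f x m + g x m).
Proof. by rewrite !lfun_act linearD. Qed.
Definition lhomD f g : lhom M N := LHom (lhomD_linear f g) (lhomD_act f g).

Fact lhomZ_linear a f x : linear (fun m : M x => a *: f x m).
Proof. by move=> b u v; rewrite linearP scalerDr !scalerA mulrC. Qed.
Fact lhomZ_act a f y x (h : hom y x) (m : M x) :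
  a *: f y (lact h m) = lact h (a *: f x m).
Proof. by rewrite lfun_act linearZ. Qed.
Definition lhomZ a f : lhom M N := LHom (lhomZ_linear a f) (lhomZ_act a f).

Fact lhom_addA : associative lhomD.
Proof. by move=> f g h; apply: lhomP => x m /=; rewrite addrA. Qed.
Fact lhom_addC : commutative lhomD.
Proof. by move=> f g; apply: lhomP => x m /=; rewrite addrC. Qed.
Fact lhom_add0 : left_id lhom0 lhomD.
Proof. by move=> f; apply: lhomP => x m /=; rewrite add0r. Qed.
Fact lhom_addN : left_inverse lhom0 lhomN lhomD.
Proof. by move=> f; apply: lhomP => x m /=; rewrite addNr. Qed.
HB.instance Definition _ :=
  GRing.isZmodule.Build (lhom M N) lhom_addA lhom_addC lhom_add0 lhom_addN.

Fact lhom_scaleA a b f : lhomZ a (lhomZ b f) = lhomZ (a * b) f.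
Proof. by apply: lhomP => x m /=; rewrite scalerA. Qed.
Fact lhom_scale1 : left_id 1 lhomZ.
Proof. by move=> f; apply: lhomP => x m /=; rewrite scale1r. Qed.
Fact lhom_scaleDr : right_distributive lhomZ +%R.
Proof. by move=> a f g; apply: lhomP => x m /=; rewrite scalerDr. Qed.
Fact lhom_scaleDl f : {morph lhomZ^~ f : a b / a + b}.
Proof. by move=> a b; apply: lhomP => x m /=; rewrite scalerDl. Qed.
HB.instance Definition _ := GRing.Zmodule_isLmodule.Build k (lhom M N)
  lhom_scaleA lhom_scale1 lhom_scaleDr lhom_scaleDl.

End HomSpace.

Definition lhom_id (M : leftmod C) : lhom M M :=
  @LHom M M (fun x m => m) (fun x a u v => erefl) (fun y x f m => erefl).

Section Composition.
Variables (M N L : leftmod C) (g : lhom N L) (f : lhom M N).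

Fact lhom_comp_linear x : linear (fun m : M x => g x (f x m)).
Proof. by move=> a u v; rewrite !linearP. Qed.
Fact lhom_comp_act y x (h : hom y x) (m : M x) :
  g y (f y (lact h m)) = lact h (g x (f x m)).
Proof. by rewrite !lfun_act. Qed.
Definition lhom_comp : lhom M L := LHom lhom_comp_linear lhom_comp_act.

End Composition.

Definition lhom_iso (M N : leftmod C) (f : lhom M N) : Prop :=
  exists g : lhom N M, lhom_comp g f = lhom_id M /\ lhom_comp f g = lhom_id N.

Definition lhom_surj (M N : leftmod C) (f : lhom M N) : Prop :=
  forall x (n : N x), exists m : M x, f x m = n.

Definition projective (P : leftmod C) : Prop :=
  forall (M N : leftmod C) (g : lhom M N) (h : lhom P N), lhom_surj g ->
    exists h' : lhom P M, lhom_comp g h' = h.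

Definition fin_generated (M : leftmod C) : Prop :=
  exists (n : nat) (x : 'I_n -> C) (m : forall i, M (x i)),
    forall y (u : M y), exists f : forall i, hom y (x i),
      u = \sum_(i < n) lact (f i) (m i).

Section ModuleSum.
Variables (I : Type) (M : I -> leftmod C).

Fact lsum_fin y x (f : hom y x) (u : dsum (fun i => M i x)) :
  finite_set [set i | lact f (u i) <> 0].
Proof.
apply: (sub_finite_set _ (dsum_fin u)) => i /= H E.
by apply: H; rewrite E linear0.
Qed.

Definition lsum_act y x (f : hom y x) (u : dsum (fun i => M i x)) :
  dsum (fun i => M i y) := DSum (lsum_fin f u).

Fact lsum_act_bilinear y x : bilinear_for *:%R *:%R (@lsum_act y x).
Proof.
split=> [u a f g|f a u v] /=; apply: dsumP => i /=.
  exact: (lact_bilinear (M i) y x).1.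
exact: (lact_bilinear (M i) y x).2.
Qed.
Fact lsum_actA z y x (g : hom z y) (f : hom y x) u :
  lsum_act g (lsum_act f u) = lsum_act (cmp g f) u.
Proof. by apply: dsumP => i /=; rewrite lactA. Qed.
Fact lsum_act1 x u : lsum_act (idm x) u = u.
Proof. by apply: dsumP => i /=; rewrite lact1. Qed.

Definition lsum : leftmod C := LeftMod lsum_act_bilinear lsum_actA lsum_act1.

End ModuleSum.

Definition generators (Y : Type) (U : Y -> leftmod C) : Prop :=
  forall M : leftmod C, exists (I : Type) (c : I -> Y)
    (f : lhom (lsum (fun i => U (c i))) M), lhom_surj f.

Definition fg_projective_generators (Y : Type) (U : Y -> leftmod C) : Prop :=
  [/\ forall y, projective (U y), forall y, fin_generated (U y) & generators U].

End ModuleCategory.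

Record lfunctor (k : fieldType) (C D : lincat k) := LFunctor {
  fob :> leftmod C -> leftmod D;
  fmor : forall M N, lhom M N -> lhom (fob M) (fob N);
  fmor_linear : forall M N, linear (@fmor M N);
  fmor_id : forall M, fmor (lhom_id M) = lhom_id (fob M);
  fmor_comp : forall M N L (g : lhom N L) (f : lhom M N),
    fmor (lhom_comp g f) = lhom_comp (fmor g) (fmor f) }.

Arguments fmor {k C D} F {M N} f : rename.

Section Functors.
Variable k : fieldType.

Definition lfunctor_id (C : lincat k) : lfunctor C C :=
  @LFunctor k C C id (fun M N f => f) (fun M N a f g => erefl)
    (fun M => erefl) (fun M N L g f => erefl).

Section Composition.
Variables (C D E : lincat k) (G : lfunctor D E) (F : lfunctor C D).

Fact lfunctor_comp_linear M N :
  linear (fun f : lhom M N => fmor G (fmor F f)).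
Proof. by move=> a f g; rewrite !fmor_linear. Qed.
Fact lfunctor_comp_id M : fmor G (fmor F (lhom_id M)) = lhom_id (G (F M)).
Proof. by rewrite !fmor_id. Qed.
Fact lfunctor_comp_comp M N L (g : lhom N L) (f : lhom M N) :
  fmor G (fmor F (lhom_comp g f)) =
  lhom_comp (fmor G (fmor F g)) (fmor G (fmor F f)).
Proof. by rewrite !fmor_comp. Qed.
Definition lfunctor_comp : lfunctor C E :=
  LFunctor lfunctor_comp_linear lfunctor_comp_id lfunctor_comp_comp.

End Composition.

Definition nat_iso (C D : lincat k) (F G : lfunctor C D) : Prop :=
  exists t : forall M : leftmod C, lhom (F M) (G M),
    (forall M, lhom_iso (t M)) /\
    (forall M N (f : lhom M N),
       lhom_comp (t N) (fmor F f) = lhom_comp (fmor G f) (t M)).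

Definition morita_equivalent (C D : lincat k) : Prop :=
  exists (F : lfunctor C D) (G : lfunctor D C),
    nat_iso (lfunctor_comp G F) (lfunctor_id C) /\
    nat_iso (lfunctor_comp F G) (lfunctor_id D).

End Functors.

(* Main.v *)
From HB Require Import structures.
From mathcomp Require Import all_boot all_algebra.
From mathcomp Require Import sesquilinear boolp classical_sets.
Require Import Defs.

Set Implicit Arguments.
Unset Strict Implicit.
Unset Printing Implicit Defensive.

Import GRing.Theory.
Local Open Scope ring_scope.

(** Tensoring with a bimodule P is a linear functor on left modules, and every
    equivalence is of this kind on the representable modules D_y = D(-, y);
    both directions of the equivalence come from making this precise.

    From bimodules to an equivalence: the functors are Q (x) - and P (x) -.
    Given phi : P (x) Q -> C, the map p (x) (q (x) m) |-> phi(p (x) q) m from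
    P (x) (Q (x) M) to M is natural in M ([counit]).  When phi is invertible,
    so is this map: its inverse sends m to the element of P (x) (Q (x) M)
    obtained from phi^-1(1) by tensoring on the right with m ([counit_iso]).

    From an equivalence (F, G) to bimodules: put Q(y, x) = F(C_x)(y) and
    P(x, y) = G(D_y)(x), with right actions given by functoriality ([watts]).
    For n in N(y) let yoneda n : D_y -> N be the map sending 1 to n.  The
    bimodule map P (x) Q -> C is evaluation, p (x) q |-> G(yoneda q)(p), which
    lies in G(F(C_x)) = C_x ([ev]).  Two facts make it invertible.  First, the
    images of all the G(yoneda n) span G N: the quotient of G N by their span
    is, up to isomorphism, G of a map out of N killing every n, hence zero
    ([elements_span]).  Second, writing the element of G(F(C_x)) that
    corresponds to 1 in this way and pulling the coefficients back along the
    fully faithful G exhibits a finite dual basis of F(C_x),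
    id = sum_i yoneda(n_i) o f_i with f_i : F(C_x) -> D_(y_i) ([dual_basis]).
    The inverse of evaluation is then v |-> sum_i G(f_i)(v) (x) n_i
    ([ev_iso]).

    The columns P_y: since Q (x) P_y is isomorphic to D_y, a lifting problem
    out of P_y becomes, after applying Q (x) -, a lifting problem out of a
    representable module, solved by the Yoneda lemma; P (x) - carries the
    solution back ([column_projective]).  If psi : Q (x) P -> D is the other
    isomorphism and psi^-1(1_y) = sum_i q_i (x) p_i, the p_i generate P_y
    ([column_fin_generated]).  Finally M = P (x) (Q (x) M) is covered by the
    maps P_y -> P (x) N, p |-> p (x) n ([column_generators]).  The statement
    about Q is the same one with the roles of the categories exchanged. *)

(** * Linear maps, module maps and inverses *)

Section LinearMaps.
Variable k : fieldType.

Lemma linear_compose (U V W : lmodType k) (f : V -> W) (g : U -> V) :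
  linear f -> linear g -> linear (fun u => f (g u)).
Proof. by move=> lf lg a u v; rewrite lg lf. Qed.

Lemma linear_lincomb (U V : lmodType k) (f g : U -> V) a :
  linear f -> linear g -> linear (fun u => a *: f u + g u).
Proof.
move=> lf lg b u v; rewrite lf lg !scalerDr !scalerA addrACA.
by rewrite (mulrC a b).
Qed.

Lemma linear_big (U V : lmodType k) (T : Type) (s : seq T) (f : T -> U -> V) :
  (forall t, linear (f t)) -> linear (fun u => \sum_(t <- s) f t u).
Proof.
move=> lf a u v; rewrite scaler_sumr -big_split /=.
by apply: eq_bigr => t _; rewrite lf.
Qed.

Lemma linear_fun_sum (U V : lmodType k) (f : U -> V) (T : Type) (s : seq T)
    (u : T -> U) : linear f -> f (\sum_(t <- s) u t) = \sum_(t <- s) f (u t).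
Proof.
move=> lf; pose fL := GRing.isLinear.Build k U V *:%R f lf.
pose f' : {linear U -> V} := HB.pack f fL.
exact: (linear_sum f').
Qed.

Lemma linear_fun0 (U V : lmodType k) (f : U -> V) : linear f -> f 0 = 0.
Proof.
by move=> lf; have := linear_fun_sum (Nil nat) (fun=> 0) lf; rewrite !big_nil.
Qed.

(** A range that is stable under scaling spans by plain sums, without
    coefficients; sums are indexed by sequences so that they concatenate. *)
Lemma lspan_range (V : lmodType k) (T : Type) (f : T -> V) :
  (forall a t, exists t', a *: f t = f t') ->
  forall v, v \in lspan [set v | exists t, v = f t] ->
  exists s : seq T, v = \sum_(t <- s) f t.
Proof.
move=> fZ v /lspanP /(_ [pred v | `[< exists s, v = \sum_(t <- s) f t >]]) H.
apply/asboolP; apply: H => [|_ [t ->]]; last first.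
  by apply/asboolP; exists [:: t]; rewrite big_seq1.
split=> [|a u w]; first by apply/asboolP; exists [::]; rewrite big_nil.
move=> /asboolP [s ->] /asboolP [s' ->]; apply/asboolP.
have [s'' ->] : exists s'', a *: \sum_(t <- s) f t = \sum_(t <- s'') f t.
  elim: s => [|t s [s'' E]]; first by exists [::]; rewrite !big_nil scaler0.
  have [t' Et] := fZ a t; exists (t' :: s'').
  by rewrite !big_cons scalerDr Et E.
by exists (s'' ++ s'); rewrite big_cat.
Qed.

End LinearMaps.

Section ModuleMaps.
Variables (k : fieldType) (C : lincat k) (M N : leftmod C).

Lemma lhom_congr (f g : lhom M N) : f = g -> forall x (m : M x), f x m = g x m.
Proof. by move=> ->. Qed.

Lemma lfunD (f : lhom M N) x : {morph @lfun _ _ _ _ f x : u v / u + v}.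
Proof. by move=> u v; rewrite linearD. Qed.

Lemma lhom_sumE (T : Type) (s : seq T) (f : T -> lhom M N) y (m : M y) :
  (\sum_(i <- s) f i) y m = \sum_(i <- s) f i y m.
Proof. by elim: s => [|i s IH]; rewrite ?big_nil // !big_cons -IH. Qed.

End ModuleMaps.

Section Inverses.
Variable k : fieldType.

(** That g is a morphism follows on applying the injective map f to both sides
    of each identity. *)
Lemma lhom_isoP (C : lincat k) (M N : leftmod C) (f : lhom M N)
    (g : forall x, N x -> M x) :
  (forall x, cancel (@lfun _ _ _ _ f x) (@g x)) ->
  (forall x, cancel (@g x) (@lfun _ _ _ _ f x)) -> lhom_iso f.
Proof.
move=> fK gK; have f_inj x := can_inj (fK x).
have g_lin x : linear (@g x).
  by move=> a u v; apply: f_inj; rewrite gK lfun_linear !gK.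
have g_act y x (h : hom y x) (n : N x) : g y (lact h n) = lact h (g x n).
  by apply: f_inj; rewrite gK lfun_act gK.
exists (LHom g_lin g_act).
by split; apply: lhomP => x m /=; [exact: fK | exact: gK].
Qed.

Lemma bimod_isoP (C D : lincat k) (P Q : bimod C D) (f : bihom P Q)
    (g : forall x y, Q x y -> P x y) :
  (forall x y, cancel (@bfun _ _ _ _ _ f x y) (@g x y)) ->
  (forall x y, cancel (@g x y) (@bfun _ _ _ _ _ f x y)) -> bimod_iso P Q.
Proof.
move=> fK gK; have f_inj x y := can_inj (fK x y).
have g_lin x y : linear (@g x y).
  by move=> a u v; apply: f_inj; rewrite gK bfun_linear !gK.
have g_lact x' x y (h : hom x' x) (q : Q x y) :
    g x' y (blact h q) = blact h (g x y q).
  by apply: f_inj; rewrite gK bfun_lact gK.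
have g_ract x y y' (q : Q x y) (h : hom y y') :
    g x y' (bract q h) = bract (g x y q) h.
  by apply: f_inj; rewrite gK bfun_ract gK.
by exists f, (BiHom g_lin g_lact g_ract) => x y; split; [exact: fK | exact: gK].
Qed.

End Inverses.

(** * Tensoring left modules with a bimodule *)

Section TensorElements.
Variables (k : fieldType) (C : lincat k) (M : rightmod C) (N : leftmod C).

(** The quotient map by the span of the pure tensors agrees with 0 on pure
    tensors, hence everywhere. *)
Lemma tpure_spans (t : tens M N) :
  t \in lspan [set t | exists w : {x : C & (M x * N x)%type},
                         t = tpure (projT2 w).1 (projT2 w).2].
Proof.
set S := [set _ | _]%classic.
suff: quo_pi S t = 0.
  by move=> E; have /quo_piE : quo_pi S t = quo_pi S 0 by
     [rewrite E linear0]; rewrite subr0.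
move: t; apply: (tens_ext (f := fun t => quo_pi S t) (g := fun=> 0)).
- exact: quo_pi_linear.
- by move=> a u v; rewrite scaler0 addr0.
by move=> x m n; apply: quo_pi0; exists (existT _ x (m, n)).
Qed.

Lemma tens_sum_pure (t : tens M N) :
  exists s : seq {x : C & (M x * N x)%type},
    t = \sum_(w <- s) tpure (projT2 w).1 (projT2 w).2.
Proof.
apply: lspan_range (tpure_spans t) => a [x [m n]].
exists (existT _ x (a *: m, n)) => /=.
have := (tpure_bilinear M N x).1 n a m 0.
by rewrite !addr0 (linear_fun0 ((tpure_bilinear M N x).1 n)) addr0 => ->.
Qed.

End TensorElements.

Section LeftTensor.
Variables (k : fieldType) (C D : lincat k) (P : bimod C D) (N : leftmod D).

(** The carrier and action agree by conversion with those of the columns of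
   btens, so that a column of P (x) Q can be used as P (x) (column of Q). *)
Definition ltens_car (x : C) : lmodType k := tens (brow P x) N.

Definition ltens_pure x (y : D) (p : P x y) (n : N y) : ltens_car x :=
  @tpure k D (brow P x) N y p n.

Lemma ltens_pureL x (y : D) (n : N y) :
  linear (fun p : P x y => ltens_pure p n).
Proof. exact: (tpure_bilinear (brow P x) N y).1. Qed.
Lemma ltens_pureR x (y : D) (p : P x y) :
  linear (fun n : N y => ltens_pure p n).
Proof. exact: (tpure_bilinear (brow P x) N y).2. Qed.
Lemma ltens_balanced x (y y' : D) (p : P x y) (g : hom y y') (n : N y') :
  ltens_pure (bract p g) n = ltens_pure p (lact g n).
Proof. exact: (@tpure_balanced _ _ (brow P x) N). Qed.

Lemma ltens_ext x (U : lmodType k) (f g : ltens_car x -> U) :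
  linear f -> linear g ->
  (forall y (p : P x y) (n : N y), f (ltens_pure p n) = g (ltens_pure p n)) ->
  f =1 g.
Proof. exact: tens_ext. Qed.

Section Lift.
Variables (x : C) (U : lmodType k) (f : forall y, P x y -> N y -> U).
Hypotheses (fL : forall y n, linear (fun p : P x y => f p n))
  (fR : forall y (p : P x y), linear (f p))
  (fB : forall y y' (p : P x y) (g : hom y y') (n : N y'),
    f (bract p g) n = f p (lact g n)).

Definition ltens_lift : ltens_car x -> U :=
  @tens_lift k D (brow P x) N U f.

Let f_bil y : bilinear_for *:%R *:%R (@f y : brow P x y -> N y -> U).
Proof. by split=> [n|p]; [exact: fL | exact: fR]. Qed.

Lemma ltens_lift_linear : linear ltens_lift.
Proof. exact: (tens_lift_linear f_bil fB). Qed.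
Lemma ltens_lift_pure y (p : P x y) (n : N y) :
  ltens_lift (ltens_pure p n) = f p n.
Proof. exact: (tens_lift_pure f_bil fB). Qed.

End Lift.

Definition ltens_act (x' x : C) (f : hom x' x) : ltens_car x -> ltens_car x' :=
  ltens_lift (fun y (p : P x y) (n : N y) => ltens_pure (blact f p) n).

Let actL x' x (f : hom x' x) y (n : N y) :
  linear (fun p : P x y => ltens_pure (blact f p) n).
Proof.
exact: (linear_compose (ltens_pureL n) ((blact_bilinear P x' x y).2 f)).
Qed.
Let actR x' x (f : hom x' x) y (p : P x y) :
  linear (fun n : N y => ltens_pure (blact f p) n).
Proof. exact: ltens_pureR. Qed.
Let actB x' x (f : hom x' x) y y' (p : P x y) (g : hom y y') (n : N y') :
  ltens_pure (blact f (bract p g)) n = ltens_pure (blact f p) (lact g n).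
Proof. by rewrite -blractA ltens_balanced. Qed.

Lemma ltens_act_linear x' x (f : hom x' x) : linear (ltens_act f).
Proof.
exact: (ltens_lift_linear (@actL x' x f) (@actR x' x f) (@actB x' x f)).
Qed.
Lemma ltens_act_pure x' x (f : hom x' x) y (p : P x y) (n : N y) :
  ltens_act f (ltens_pure p n) = ltens_pure (blact f p) n.
Proof.
exact: (ltens_lift_pure (@actL x' x f) (@actR x' x f) (@actB x' x f)).
Qed.

Fact ltens_act_bilinear x' x : bilinear_for *:%R *:%R (@ltens_act x' x).
Proof.
split=> [t a f g|f]; last exact: ltens_act_linear.
move: t; apply: (ltens_ext (f := ltens_act _)
  (g := fun t => a *: ltens_act f t + ltens_act g t)).
- exact: ltens_act_linear.
- by apply: linear_lincomb; exact: ltens_act_linear.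
move=> y p n; rewrite !ltens_act_pure.
by rewrite (blact_bilinear P x' x y).1 ltens_pureL.
Qed.

Fact ltens_actA x'' x' x (g : hom x'' x') (f : hom x' x) (t : ltens_car x) :
  ltens_act g (ltens_act f t) = ltens_act (cmp g f) t.
Proof.
move: t; apply: (ltens_ext (f := fun t => ltens_act g (ltens_act f t))).
- by apply: linear_compose; exact: ltens_act_linear.
- exact: ltens_act_linear.
by move=> y p n; rewrite !ltens_act_pure blactA.
Qed.

Fact ltens_act1 x (t : ltens_car x) : ltens_act (idm x) t = t.
Proof.
move: t; apply: (ltens_ext (f := ltens_act _) (g := id)) => //.
  exact: ltens_act_linear.
by move=> y p n; rewrite ltens_act_pure blact1.
Qed.

Definition ltens : leftmod C :=
  LeftMod ltens_act_bilinear ltens_actA ltens_act1.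

End LeftTensor.

Section TensorFunctor.
Variables (k : fieldType) (C D : lincat k) (P : bimod C D).

Section Map.
Variables (M N : leftmod D) (f : lhom M N).

Let mapL x y (m : M y) : linear (fun p : P x y => ltens_pure p (f y m)).
Proof. exact: ltens_pureL. Qed.
Let mapR x y (p : P x y) : linear (fun m : M y => ltens_pure p (f y m)).
Proof. exact: (linear_compose (ltens_pureR p) (@lfun_linear _ _ _ _ f y)). Qed.
Let mapB x y y' (p : P x y) (g : hom y y') (m : M y') :
  ltens_pure (bract p g) (f y' m) = ltens_pure p (f y (lact g m)).
Proof. by rewrite ltens_balanced lfun_act. Qed.

Definition ltens_map_fun x : ltens P M x -> ltens P N x :=
  ltens_lift (fun y (p : P x y) m => ltens_pure p (f y m)).

Lemma ltens_map_linear x : linear (@ltens_map_fun x).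
Proof. exact: (ltens_lift_linear (@mapL x) (@mapR x) (@mapB x)). Qed.
Lemma ltens_map_fun_pure x y (p : P x y) (m : M y) :
  ltens_map_fun (ltens_pure p m) = ltens_pure p (f y m).
Proof. exact: (ltens_lift_pure (@mapL x) (@mapR x) (@mapB x)). Qed.

Lemma ltens_map_act x' x (h : hom x' x) (t : ltens P M x) :
  ltens_map_fun (lact h t) = lact h (ltens_map_fun t).
Proof.
move: t; apply: (ltens_ext (f := fun t => ltens_map_fun (ltens_act h t))
  (g := fun t => ltens_act h (ltens_map_fun t))).
- exact: linear_compose (@ltens_map_linear x') (ltens_act_linear h).
- exact: linear_compose (ltens_act_linear h) (@ltens_map_linear x).
by move=> y p m; rewrite !(ltens_act_pure, ltens_map_fun_pure).
Qed.

Definition ltens_map : lhom (ltens P M) (ltens P N) :=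
  LHom ltens_map_linear ltens_map_act.

Lemma ltens_map_pure x y (p : P x y) (m : M y) :
  ltens_map x (ltens_pure p m) = ltens_pure p (f y m).
Proof. exact: ltens_map_fun_pure. Qed.

End Map.

Lemma lhom_ltens_ext (M : leftmod D) (N : leftmod C)
    (f g : lhom (ltens P M) N) :
  (forall x y (p : P x y) (m : M y),
     f x (ltens_pure p m) = g x (ltens_pure p m)) -> f = g.
Proof.
move=> fg; apply: lhomP => x.
apply: (ltens_ext (f := @lfun _ _ _ _ f x) (g := @lfun _ _ _ _ g x)).
- exact: (@lfun_linear _ _ _ _ f x).
- exact: (@lfun_linear _ _ _ _ g x).
exact: fg.
Qed.

Fact ltens_map_lin M N : linear (@ltens_map M N).
Proof.
move=> a f g; apply: lhom_ltens_ext => x y p m.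
by rewrite ltens_map_pure /= ltens_pureR !ltens_map_fun_pure.
Qed.
Fact ltens_map_id M : ltens_map (lhom_id M) = lhom_id (ltens P M).
Proof. by apply: lhom_ltens_ext => x y p m; rewrite ltens_map_pure. Qed.
Fact ltens_map_comp M N L (g : lhom N L) (f : lhom M N) :
  ltens_map (lhom_comp g f) = lhom_comp (ltens_map g) (ltens_map f).
Proof.
by apply: lhom_ltens_ext => x y p m; rewrite /= !ltens_map_fun_pure.
Qed.

Definition tensor_functor : lfunctor D C :=
  LFunctor ltens_map_lin ltens_map_id ltens_map_comp.

End TensorFunctor.

(** * Invertible bimodules give an equivalence *)

Section Associator.
Variables (k : fieldType) (C D E : lincat k).
Variables (P : bimod C D) (Q : bimod D E) (M : leftmod E).

Lemma btens_pureL x z (y : D) (q : Q y z) :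
  linear (fun p : P x y => btens_pure p q).
Proof. exact: (ltens_pureL (N := bcol Q z)). Qed.
Lemma btens_pureR x z (y : D) (p : P x y) :
  linear (fun q : Q y z => btens_pure p q).
Proof. exact: (ltens_pureR (N := bcol Q z)). Qed.
Lemma btens_balanced x z (y y' : D) (p : P x y) (g : hom y y') (q : Q y' z) :
  btens_pure (bract p g) q = btens_pure p (blact g q).
Proof. exact: (ltens_balanced (N := bcol Q z)). Qed.

Section Fun.
Variables (x : C) (z : E) (m : M z).

Let assocL y (q : Q y z) :
  linear (fun p : P x y => ltens_pure p (ltens_pure q m : ltens Q M y)).
Proof. exact: ltens_pureL. Qed.
Let assocR y (p : P x y) :
  linear (fun q : Q y z => ltens_pure p (ltens_pure q m : ltens Q M y)).
Proof.
exact: (linear_compose (V := ltens Q M y) (g := fun q => ltens_pure q m)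
  (@ltens_pureR _ _ _ P (ltens Q M) x y p) (ltens_pureL m)).
Qed.
Let assocB y y' (p : P x y) (g : hom y y') (q : Q y' z) :
  ltens_pure (bract p g) (ltens_pure q m : ltens Q M y') =
  ltens_pure p (ltens_pure (blact g q) m : ltens Q M y).
Proof. by rewrite ltens_balanced /= ltens_act_pure. Qed.

(** One component of the associator (P (x) Q) (x) M -> P (x) (Q (x) M), taken
    for a fixed m, which avoids forming the triple tensor product; the inverse
    of [counit] is its value at phi^-1(1). *)
Definition assoc : btens P Q x z -> ltens P (ltens Q M) x :=
  ltens_lift (N := bcol Q z)
    (fun y (p : P x y) (q : Q y z) =>
       ltens_pure p (ltens_pure q m : ltens Q M y)).

Lemma assoc_linear : linear assoc.
Proof. exact: (ltens_lift_linear (N := bcol Q z) assocL assocR assocB). Qed.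
Lemma assoc_pure y (p : P x y) (q : Q y z) :
  assoc (btens_pure p q) = ltens_pure p (ltens_pure q m : ltens Q M y).
Proof. exact: (ltens_lift_pure (N := bcol Q z) assocL assocR assocB). Qed.

End Fun.

Lemma assoc_lact x' x z (f : hom x' x) (m : M z) (u : btens P Q x z) :
  assoc m (blact f u) = lact f (assoc m u).
Proof.
move: u; apply: (btens_ext (f := fun u => assoc m (btens_lact f u))
  (g := fun u => ltens_act f (assoc m u))).
- exact: linear_compose (assoc_linear m) (btens_lact_linear f).
- exact: linear_compose (ltens_act_linear f) (assoc_linear m).
by move=> y p q; rewrite btens_lact_pure !assoc_pure ltens_act_pure.
Qed.

(** Both sides send p (x) q to p (x) q (x) f m, by balancing over E. *)
Lemma assoc_ract x z z' (f : hom z z') (m : M z') (u : btens P Q x z) :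
  assoc m (bract u f) = assoc (lact f m) u.
Proof.
move: u; apply: (btens_ext (f := fun u => assoc m (btens_ract u f))
  (g := assoc (lact f m))).
- exact: linear_compose (assoc_linear m)
    (btens_ract_linear (P := P) (Q := Q) f).
- exact: assoc_linear.
move=> y p q; rewrite btens_ract_pure !assoc_pure.
by rewrite -(ltens_balanced q f m).
Qed.

End Associator.

Section Counit.
Variables (k : fieldType) (C D : lincat k) (P : bimod C D) (Q : bimod D C).
Variable phi : bihom (btens P Q) (regular C).

Section Module.
Variable M : leftmod C.

Section Inner.
Variables (x : C) (y : D) (p : P x y).

Let innL z (m : M z) :
  linear (fun q : Q y z => lact (phi x z (btens_pure p q) : hom x z) m).
Proof.
move=> a q q'; rewrite btens_pureR bfun_linear.
exact: (lact_bilinear M x z).1.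
Qed.
Let innR z (q : Q y z) :
  linear (fun m : M z => lact (phi x z (btens_pure p q) : hom x z) m).
Proof. exact: (lact_bilinear M x z).2. Qed.
Let innB z z' (q : Q y z) (g : hom z z') (m : M z') :
  lact (phi x z' (btens_pure p (bract q g)) : hom x z') m =
  lact (phi x z (btens_pure p q) : hom x z) (lact g m).
Proof. by rewrite -btens_ract_pure (bfun_ract phi) lactA. Qed.

Definition counit_inner : ltens Q M y -> M x :=
  ltens_lift (fun z (q : Q y z) m =>
    lact (phi x z (btens_pure p q) : hom x z) m).
Lemma counit_inner_linear : linear counit_inner.
Proof. exact: (ltens_lift_linear innL innR innB). Qed.
Lemma counit_inner_pure z (q : Q y z) (m : M z) :
  counit_inner (ltens_pure q m) = lact (phi x z (btens_pure p q) : hom x z) m.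
Proof. exact: (ltens_lift_pure innL innR innB). Qed.

End Inner.

Lemma counit_innerL x y (w : ltens Q M y) :
  linear (fun p : P x y => counit_inner p w).
Proof.
move=> a p p'; move: w.
apply: (ltens_ext (f := counit_inner _)
  (g := fun w => a *: counit_inner p w + counit_inner p' w)).
- exact: counit_inner_linear.
- by apply: linear_lincomb; exact: counit_inner_linear.
move=> z q m; rewrite !counit_inner_pure btens_pureL bfun_linear.
exact: (lact_bilinear M x z).1.
Qed.

Lemma counit_innerB x y y' (p : P x y) (g : hom y y') (w : ltens Q M y') :
  counit_inner (bract p g) w = counit_inner p (lact g w).
Proof.
move: w; apply: (ltens_ext (f := counit_inner (bract p g))
  (g := fun w => counit_inner p (ltens_act g w))).
- exact: counit_inner_linear.
- exact: linear_compose (counit_inner_linear p) (ltens_act_linear g).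
by move=> z q m; rewrite ltens_act_pure !counit_inner_pure btens_balanced.
Qed.

Definition counit_fun x : ltens P (ltens Q M) x -> M x :=
  ltens_lift (fun y (p : P x y) w => counit_inner p w).

Lemma counit_fun_linear x : linear (@counit_fun x).
Proof.
exact: (ltens_lift_linear (@counit_innerL x) (@counit_inner_linear x)
  (@counit_innerB x)).
Qed.
Lemma counit_fun_pure x y z (p : P x y) (q : Q y z) (m : M z) :
  counit_fun (ltens_pure p (ltens_pure q m : ltens Q M y)) =
  lact (phi x z (btens_pure p q) : hom x z) m.
Proof.
rewrite -counit_inner_pure.
exact: (ltens_lift_pure (@counit_innerL x) (@counit_inner_linear x)
  (@counit_innerB x)).
Qed.

End Module.

Lemma ltens2_ext (M : leftmod C) x (U : lmodType k)
    (f g : ltens P (ltens Q M) x -> U) : linear f -> linear g ->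
  (forall y z (p : P x y) (q : Q y z) (m : M z),
     f (ltens_pure p (ltens_pure q m : ltens Q M y)) =
     g (ltens_pure p (ltens_pure q m : ltens Q M y))) -> f =1 g.
Proof.
move=> lf lg fg; apply: ltens_ext => // y p.
apply: (ltens_ext (f := fun w : ltens Q M y => f (ltens_pure p w))
  (g := fun w : ltens Q M y => g (ltens_pure p w))).
- exact: linear_compose lf (ltens_pureR p).
- exact: linear_compose lg (ltens_pureR p).
by move=> z q m; exact: fg.
Qed.

Lemma counit_fun_act (M : leftmod C) x' x (f : hom x' x)
    (w : ltens P (ltens Q M) x) :
  counit_fun (lact f w) = lact f (counit_fun w).
Proof.
move: w; apply: (ltens2_ext (f := fun w => counit_fun (ltens_act f w))
  (g := fun w => lact f (counit_fun w))).
- exact: linear_compose (@counit_fun_linear M x') (ltens_act_linear f).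
- exact: linear_compose ((lact_bilinear M x' x).2 f) (@counit_fun_linear M x).
move=> y z p q m; rewrite ltens_act_pure !counit_fun_pure lactA.
by rewrite -btens_lact_pure (bfun_lact phi).
Qed.

Definition counit (M : leftmod C) : lhom (ltens P (ltens Q M)) M :=
  LHom (@counit_fun_linear M) (@counit_fun_act M).

Lemma counit_pure (M : leftmod C) x y z (p : P x y) (q : Q y z) (m : M z) :
  counit M x (ltens_pure p (ltens_pure q m : ltens Q M y)) =
  lact (phi x z (btens_pure p q) : hom x z) m.
Proof. exact: counit_fun_pure. Qed.

Lemma counit_assoc (M : leftmod C) x z (m : M z) (u : btens P Q x z) :
  counit M x (assoc m u) = lact (phi x z u : hom x z) m.
Proof.
move: u; apply: (btens_ext (f := fun u => counit_fun (assoc m u))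
  (g := fun u => lact (phi x z u : hom x z) m)).
- exact: linear_compose (@counit_fun_linear M x)
    (@assoc_linear _ _ _ _ _ _ _ x z m).
- exact: linear_compose ((lact_bilinear M x z).1 m)
    (@bfun_linear _ _ _ _ _ phi x z).
by move=> y p q; rewrite assoc_pure counit_fun_pure.
Qed.

Lemma counit_natural (M N : leftmod C) (f : lhom M N) :
  lhom_comp (counit N) (ltens_map P (ltens_map Q f)) = lhom_comp f (counit M).
Proof.
apply: lhomP => x.
apply: (ltens2_ext (f := lhom_comp (counit N) _ x) (g := lhom_comp f _ x)).
- exact: lhom_comp_linear.
- exact: lhom_comp_linear.
move=> y z p q m /=.
by rewrite ltens_map_fun_pure ltens_map_pure !counit_fun_pure lfun_act.
Qed.

Section Iso.
Variable psi : bihom (regular C) (btens P Q).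
Hypothesis phiK : forall x y,
  cancel (@bfun _ _ _ _ _ phi x y) (@bfun _ _ _ _ _ psi x y).
Hypothesis psiK : forall x y,
  cancel (@bfun _ _ _ _ _ psi x y) (@bfun _ _ _ _ _ phi x y).

(** The inverse is m |-> phi^-1(1) (x) m.  On one side phi(phi^-1(1)) m = m.
    On the other, for f = phi(p (x) q) the right linearity of phi^-1 gives
    phi^-1(1) (x) f m = phi^-1(1) f (x) m = phi^-1(f) (x) m, which is
    (p (x) q) (x) m. *)
Lemma counit_iso (M : leftmod C) : lhom_iso (counit M).
Proof.
apply: (lhom_isoP (g := fun x (m : M x) => assoc m (psi x x (idm x)))) => x.
  have psi_act z (f : hom x z) (m : M z) :
      assoc (lact f m) (psi x x (idm x)) = assoc m (psi x z f).
    by rewrite -assoc_ract -bfun_ract /= cmp1m.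
  have assoc_linm : linear (fun m : M x => assoc (Q := Q) m (psi x x (idm x))).
    move=> a m m'; move: (psi x x (idm x)).
    apply: (btens_ext (f := assoc _)
      (g := fun u => a *: assoc m u + assoc m' u)).
    - exact: assoc_linear.
    - by apply: linear_lincomb; exact: assoc_linear.
    move=> y p q; rewrite !assoc_pure -ltens_pureR; congr ltens_pure.
    exact: ltens_pureR.
  apply: (ltens2_ext (f := fun w => assoc (counit_fun w) (psi x x (idm x)))
    (g := id)) => //.
    exact: linear_compose assoc_linm (@counit_fun_linear M x).
  by move=> y z p q m; rewrite counit_fun_pure psi_act phiK assoc_pure.
by move=> m; rewrite counit_assoc psiK lact1.
Qed.

End Iso.
End Counit.

Lemma tensor_counit (k : fieldType) (C D : lincat k)
    (P : bimod C D) (Q : bimod D C) :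
  bimod_iso (btens P Q) (regular C) ->
  nat_iso (lfunctor_comp (tensor_functor P) (tensor_functor Q)) (lfunctor_id C).
Proof.
move=> [phi [psi K]]; exists (counit phi); split; last exact: counit_natural.
by apply: (counit_iso (psi := psi)) => x y; have [] := K x y.
Qed.

Lemma tensor_morita (k : fieldType) (C D : lincat k)
    (P : bimod C D) (Q : bimod D C) :
  bimod_iso (btens P Q) (regular C) -> bimod_iso (btens Q P) (regular D) ->
  morita_equivalent C D.
Proof.
move=> PQ QP; exists (tensor_functor Q), (tensor_functor P).
by split; exact: tensor_counit.
Qed.

(** * Representable modules *)

Section Yoneda.
Variables (k : fieldType) (C : lincat k).

Definition representable (x : C) : leftmod C := bcol (regular C) x.

(** An element m of M(x) is the same thing as a map from the module represented
   by x to M, namely the one that sends the identity to m. *)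
Section Element.
Variables (M : leftmod C) (x : C) (m : M x).

Fact yoneda_linear y :
  linear (fun f : representable x y => lact (f : hom y x) m).
Proof. exact: (lact_bilinear M y x).1. Qed.
Fact yoneda_act z y (g : hom z y) (f : representable x y) :
  lact (lact g f : hom z x) m = lact g (lact (f : hom y x) m).
Proof. by rewrite lactA. Qed.
Definition yoneda : lhom (representable x) M := LHom yoneda_linear yoneda_act.

Lemma yonedaE y (f : hom y x) : yoneda y f = lact f m.
Proof. by []. Qed.

End Element.

Lemma yoneda_id (M : leftmod C) x (u : lhom (representable x) M) :
  yoneda (u x (idm x)) = u.
Proof.
by apply: lhomP => y f; rewrite yonedaE -lfun_act /= cmpm1.
Qed.

Lemma yoneda_lin (M : leftmod C) x : linear (@yoneda M x).
Proof.
by move=> a m m'; apply: lhomP => y f /=; apply: (lact_bilinear M y x).2.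
Qed.

Lemma yoneda_comp (M N : leftmod C) x (h : lhom M N) (m : M x) :
  lhom_comp h (yoneda m) = yoneda (h x m).
Proof. by apply: lhomP => y f /=; rewrite lfun_act. Qed.

End Yoneda.

(** * Columns of an invertible bimodule *)

Section ImageSum.
Variables (k : fieldType) (C : lincat k) (I : Type) (U : I -> leftmod C).
Variables (M : leftmod C) (f : forall i, lhom (U i) M).

Let f_lin x i : linear (@lfun _ _ _ _ (f i) x).
Proof. exact: lfun_linear. Qed.

Definition lsum_lift_fun x : lsum U x -> M x :=
  dsum_lift (fun i => @lfun _ _ _ _ (f i) x).

Fact lsum_lift_linear x : linear (@lsum_lift_fun x).
Proof.
exact: (@dsum_lift_linear k I (fun i => U i x) (M x)
  (fun i => @lfun _ _ _ _ (f i) x) (@f_lin x)).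
Qed.
Lemma lsum_lift_in x i (u : U i x) :
  lsum_lift_fun (dsum_in (V := fun i => U i x) u) = f i x u.
Proof.
exact: (@dsum_lift_in k I (fun i => U i x) (M x)
  (fun i => @lfun _ _ _ _ (f i) x) (@f_lin x)).
Qed.

Fact lsum_lift_act y x (h : hom y x) (u : lsum U x) :
  lsum_lift_fun (lact h u) = lact h (lsum_lift_fun u).
Proof.
move: u; apply: (dsum_ext (f := fun u => lsum_lift_fun (lsum_act h u))
  (g := fun u => lact h (lsum_lift_fun u))).
- exact: linear_compose (@lsum_lift_linear y)
    ((lact_bilinear (lsum U) y x).2 h).
- exact: linear_compose ((lact_bilinear M y x).2 h) (@lsum_lift_linear x).
move=> i u; rewrite lsum_lift_in -lfun_act -lsum_lift_in; congr lsum_lift_fun.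
apply: dsumP => j /=; rewrite /dsum_single.
have [E|nE] := pselect (i = j).
  by case: _ / E; rewrite !(@eqtype.dfwith_in {classic I}).
have nE' : (i : {classic I}) != j by apply/eqP.
by rewrite !(@eqtype.dfwith_out {classic I}) // linear0.
Qed.

Definition lsum_lift : lhom (lsum U) M := LHom lsum_lift_linear lsum_lift_act.

End ImageSum.

Section Generation.
Variables (k : fieldType) (C D : lincat k) (P : bimod C D) (Q : bimod D C).
Hypothesis PQ : bimod_iso (btens P Q) (regular C).
Hypothesis QP : bimod_iso (btens Q P) (regular D).

(** Each pure tensor q (x) n lifts, by lifting n alone. *)
Lemma ltens_map_surj (M N : leftmod C) (g : lhom M N) :
  lhom_surj g -> lhom_surj (ltens_map Q g).
Proof.
move=> g_surj y w; have [s ->] := tens_sum_pure w.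
elim: s => [|[x [q n]] s [t Et]].
  by exists 0; rewrite big_nil linear0.
have [m <-] := g_surj x n.
exists (ltens_pure q m + t); rewrite big_cons -Et lfunD; congr (_ + _).
exact: ltens_map_pure.
Qed.

(** P (x) D_y = P_y, since p (x) f = p f (x) 1. *)
Lemma ltens_representable x y (w : ltens P (representable y) x) :
  exists p : P x y, w = ltens_pure p (idm y : representable y y).
Proof.
have [s ->] := tens_sum_pure w.
elim: s => [|[y' [p f]] s [p' E]].
  by exists 0; rewrite big_nil (linear_fun0 (@ltens_pureL _ _ _ P _ _ _ _)).
exists (bract (p : P x y') (f : hom y' y) + p'); rewrite big_cons E.
have := @ltens_pureL _ _ _ P (representable y) x y (idm y) 1 (bract p f) p'.
rewrite !scale1r => ->; congr (_ + _).
by rewrite (ltens_balanced p f (idm y : representable y y)) /= cmpm1.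
Qed.

Definition ltens_insert (N : leftmod D) y (n : N y) :
    lhom (bcol P y) (ltens P N) :=
  @LHom _ _ (bcol P y) (ltens P N) (fun x (p : P x y) => ltens_pure p n)
    (fun x => @ltens_pureL _ _ _ P N x y n)
    (fun x' x f p => esym (ltens_act_pure f p n)).

(** M = P (x) N with N = Q (x) M, and each element of N(y) gives a map
    P_y -> P (x) N; together these maps reach all pure tensors.  The summands
    are therefore indexed by the elements of N. *)
Lemma column_generators : generators (fun y => bcol P y).
Proof.
move=> M; have [t [t_iso t_nat]] := tensor_counit PQ.
exists {y : D & ltens Q M y}, (@projT1 _ _).
exists (lsum_lift (fun i => lhom_comp (t M) (ltens_insert (projT2 i)))) => x m.
have [t' [t'K tK]] := t_iso M.
have <- : t M x (t' x m) = m by exact: lhom_congr tK x m.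
have [s ->] := tens_sum_pure (t' x m : ltens P (ltens Q M) x).
elim: s => [|[y [p n]] s [u Eu]].
  by exists 0; rewrite big_nil !linear0.
exists (dsum_in (V := fun i : {y : D & ltens Q M y} => bcol P (projT1 i) x)
          (i := existT _ y n) p + u).
rewrite big_cons !lfunD Eu; congr (_ + _).
exact: lsum_lift_in.
Qed.

Section Column.
Variable y : D.
Variables (psi : bihom (btens Q P) (regular D)).
Variables (psi' : bihom (regular D) (btens Q P)).
Hypothesis psiK : forall y z,
  cancel (@bfun _ _ _ _ _ psi y z) (@bfun _ _ _ _ _ psi' y z).

Definition column_to_representable :
    lhom (ltens Q (bcol P y)) (representable y) :=
  @LHom _ _ (ltens Q (bcol P y)) (representable y) (fun z w => psi z y w)
   (fun z => @bfun_linear _ _ _ _ _ psi z y)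
   (fun z' z f w => bfun_lact psi f w).

Definition representable_to_column :
    lhom (representable y) (ltens Q (bcol P y)) :=
  yoneda (psi' y y (idm y) : ltens Q (bcol P y) y).

Lemma column_to_representableK :
  lhom_comp representable_to_column column_to_representable = lhom_id _.
Proof.
apply: lhomP => z w; rewrite /= -[RHS]psiK.
rewrite -[X in _ = psi' z y X]cmpm1.
exact: esym (bfun_lact psi' (psi z y w : hom z y) (idm y)).
Qed.

(** The lift is first built after applying Q (x) -, where the source is
    isomorphic to D_y: the lift l sends the image of 1_y to a preimage e of the
    prescribed value.  Then P (x) l is transported along P (x) (Q (x) M) = M. *)
Lemma column_projective : projective (bcol P y).
Proof.
move=> M N g h g_surj; have [t [t_iso t_nat]] := tensor_counit PQ.
have [e Ee] := ltens_map_surj g_surj (ltens_map Q h y (psi' y y (idm y))).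
pose l := lhom_comp (yoneda e) column_to_representable.
have gl : lhom_comp (ltens_map Q g) l = ltens_map Q h.
  transitivity (lhom_comp (lhom_comp (ltens_map Q g) (yoneda e))
      column_to_representable); first exact: lhomP.
  rewrite yoneda_comp Ee -yoneda_comp.
  transitivity (lhom_comp (ltens_map Q h)
    (lhom_comp representable_to_column column_to_representable)).
    exact: lhomP.
  by rewrite column_to_representableK; apply: lhomP.
have [t' [t'K tK]] := t_iso (bcol P y).
exists (lhom_comp (t M) (lhom_comp (ltens_map P l) t')).
transitivity (lhom_comp (lhom_comp g (t M)) (lhom_comp (ltens_map P l) t')).
  exact: lhomP.
rewrite -(t_nat _ _ g) /=.
transitivity (lhom_comp (t N) (lhom_comp
   (lhom_comp (ltens_map P (ltens_map Q g)) (ltens_map P l)) t')).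
  exact: lhomP.
rewrite -ltens_map_comp gl.
transitivity (lhom_comp (lhom_comp (t N) (ltens_map P (ltens_map Q h))) t').
  exact: lhomP.
rewrite (t_nat _ _ h).
transitivity (lhom_comp h (lhom_comp (t (bcol P y)) t')); first exact: lhomP.
by rewrite tK; apply: lhomP.
Qed.

(** Write psi^-1(1_y) = sum_i q_i (x) p_i.  Under the isomorphisms
    P_y = P (x) D_y = P (x) (Q (x) P_y) = P_y, an element p of P_y is first sent
    to p (x) 1, then to sum_i p (x) (q_i (x) p_i), and finally to
    sum_i phi(p (x) q_i) p_i.  The composite is onto, though it need not be the
    identity when phi and psi are unrelated. *)
Lemma column_fin_generated : fin_generated (bcol P y).
Proof.
have [phi [phi' K]] := PQ.
have phiK a b : cancel (@bfun _ _ _ _ _ phi a b) (@bfun _ _ _ _ _ phi' a b).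
  by case: (K a b).
have phi'K a b : cancel (@bfun _ _ _ _ _ phi' a b) (@bfun _ _ _ _ _ phi a b).
  by case: (K a b).
have [s Es] := tens_sum_pure (psi' y y (idm y) : ltens Q (bcol P y) y).
exists (size s), (fun i => projT1 (tnth (in_tuple s) i)),
  (fun i => (projT2 (tnth (in_tuple s) i)).2) => x u.
have [t' [_ tK]] := counit_iso phiK phi'K (bcol P y).
have {tK} tK : counit phi (bcol P y) x (t' x u) = u.
  exact: lhom_congr tK x u.
pose c := column_to_representable.
have Ew : t' x u =
    ltens_map P representable_to_column x (ltens_map P c x (t' x u)).
  rewrite -[RHS](lhom_congr (ltens_map_comp P _ c)).
  by rewrite column_to_representableK ltens_map_id.
have [p Ep] := ltens_representable (ltens_map P c x (t' x u)).
(* The coefficients are phi(p (x) q_i), with u the image of p (x) 1_y. *)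
exists (fun i => phi x _ (btens_pure p (projT2 (tnth (in_tuple s) i)).1)).
rewrite -[LHS]tK Ew Ep ltens_map_pure yonedaE lact1 Es.
rewrite (linear_fun_sum _ _ (@ltens_pureR _ _ _ P (ltens Q (bcol P y)) x y p)).
rewrite linear_sum big_tnth; apply: eq_bigr => i _.
exact: counit_pure.
Qed.

End Column.

Lemma column_fg_projective_generators :
  fg_projective_generators (fun y => bcol P y).
Proof.
have [psi [psi' K]] := QP.
have psiK a b : cancel (@bfun _ _ _ _ _ psi a b) (@bfun _ _ _ _ _ psi' a b)
  by case: (K a b).
split=> [y|y|].
- exact: column_projective psiK.
- exact: column_fin_generated psiK.
exact: column_generators.
Qed.

End Generation.

(** * Quotient modules; equivalences are full and faithful *)

Section QuotientModule.
Variables (k : fieldType) (C : lincat k) (M : leftmod C).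
Variable S : forall x, set (M x).
Hypothesis S_act : forall y x (f : hom y x) m, S m -> S (lact f m).

Definition lquo_act y x (f : hom y x) : quo (@S x) -> quo (@S y) :=
  quo_lift (fun m => quo_pi (@S y) (lact f m)).

Let act_lin y x (f : hom y x) :
  linear (fun m : M x => quo_pi (@S y) (lact f m)).
Proof.
exact: linear_compose (@quo_pi_linear _ _ (@S y)) ((lact_bilinear M y x).2 f).
Qed.
Let act0 y x (f : hom y x) (m : M x) : S m -> quo_pi (@S y) (lact f m) = 0.
Proof. by move=> Sm; apply: quo_pi0; exact: S_act. Qed.

Lemma lquo_act_pi y x (f : hom y x) (m : M x) :
  lquo_act f (quo_pi (@S x) m) = quo_pi (@S y) (lact f m).
Proof. exact: (quo_lift_pi (@act_lin y x f) (@act0 y x f)). Qed.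

Fact lquo_act_bilinear y x : bilinear_for *:%R *:%R (@lquo_act y x).
Proof.
split=> [q a f g|f]; last first.
  exact: (quo_lift_linear (@act_lin y x f) (@act0 y x f)).
rewrite -[q]quo_reprK !lquo_act_pi (lact_bilinear M y x).1.
exact: quo_pi_linear.
Qed.
Fact lquo_actA z y x (g : hom z y) (f : hom y x) q :
  lquo_act g (lquo_act f q) = lquo_act (cmp g f) q.
Proof. by rewrite -[q]quo_reprK !lquo_act_pi lactA. Qed.
Fact lquo_act1 x (q : quo (@S x)) : lquo_act (idm x) q = q.
Proof. by rewrite -[q]quo_reprK lquo_act_pi lact1. Qed.

Definition lquo : leftmod C := LeftMod lquo_act_bilinear lquo_actA lquo_act1.

Definition lquo_proj : lhom M lquo :=
  @LHom _ _ M lquo (fun x => quo_pi (@S x)) (fun x => @quo_pi_linear _ _ (@S x))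
    (fun y x f m => esym (lquo_act_pi f m)).

End QuotientModule.

Section LinearFunctors.
Variables (k : fieldType) (C D : lincat k).

Lemma fmor0 (F : lfunctor C D) M N : fmor F (0 : lhom M N) = 0.
Proof. exact: (linear_fun0 (@fmor_linear _ _ _ F M N)). Qed.

Lemma equivalence_faithful (F : lfunctor C D) (G : lfunctor D C) :
  nat_iso (lfunctor_comp G F) (lfunctor_id C) ->
  forall M N (f g : lhom M N), fmor F f = fmor F g -> f = g.
Proof.
move=> [t [t_iso t_nat]] M N f g fg; have [t' [_ tK]] := t_iso M.
have /= Ef := t_nat _ _ f; have /= Eg := t_nat _ _ g.
have : lhom_comp (lhom_comp f (t M)) t' = lhom_comp (lhom_comp g (t M)) t'.
  by rewrite -Ef -Eg fg.
move=> E; have {tK} tK x m : t M x (t' x m) = m.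
  exact: lhom_congr tK x m.
apply: lhomP => x m.
by have /= := lhom_congr E m; rewrite tK.
Qed.

End LinearFunctors.

(** The preimage of h is F h transported along F G = id; that G sends it back
    to h can be checked after applying the faithful functor F. *)
Lemma equivalence_full (k : fieldType) (C D : lincat k)
    (F : lfunctor C D) (G : lfunctor D C) :
  nat_iso (lfunctor_comp G F) (lfunctor_id C) ->
  nat_iso (lfunctor_comp F G) (lfunctor_id D) ->
  forall M N (h : lhom (G M) (G N)), exists f, h = fmor G f.
Proof.
move=> GF [s [s_iso s_nat]] M N h.
have [s' [s'K sK]] := s_iso M; have [r' [r'K rK]] := s_iso N.
pose f := lhom_comp (s N) (lhom_comp (fmor F h) s').
exists f; apply: (equivalence_faithful GF).
have /= Ef := s_nat _ _ f.
transitivity (lhom_comp (lhom_comp r' (s N)) (fmor F h)).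
  by rewrite r'K; apply: lhomP.
transitivity (lhom_comp r' (lhom_comp (s N)
  (lhom_comp (fmor F h) (lhom_comp s' (s M))))).
  by rewrite s'K; apply: lhomP.
transitivity (lhom_comp r' (lhom_comp f (s M))); first exact: lhomP.
rewrite -Ef.
transitivity (lhom_comp (lhom_comp r' (s N)) (fmor F (fmor G f))).
  exact: lhomP.
by rewrite r'K; apply: lhomP.
Qed.

(** * An equivalence gives invertible bimodules *)

Section WattsBimodule.
Variables (k : fieldType) (C D : lincat k) (F : lfunctor C D).

(** The bimodule of the Eilenberg-Watts theorem: the values of F on the
   representable modules. *)
Definition watts_car (y : D) (x : C) : lmodType k := F (representable x) y.
Definition watts_lact y' y x (g : hom y' y) (q : watts_car y x) :
    watts_car y' x := lact g q.
Definition watts_ract y x x' (q : watts_car y x) (f : hom x x') :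
    watts_car y x' :=
  fmor F (yoneda (f : representable x' x)) y q.

Fact watts_lact_bilinear y' y x : bilinear_for *:%R *:%R (@watts_lact y' y x).
Proof. exact: lact_bilinear. Qed.
Fact watts_lactA y'' y' y x (g : hom y'' y') (f : hom y' y)
    (q : watts_car y x) :
  watts_lact g (watts_lact f q) = watts_lact (cmp g f) q.
Proof. exact: lactA. Qed.
Fact watts_lact1 y x (q : watts_car y x) : watts_lact (idm y) q = q.
Proof. exact: lact1. Qed.
Fact watts_ract_bilinear y x x' : bilinear_for *:%R *:%R (@watts_ract y x x').
Proof.
split=> [f|q a f g]; first exact: lfun_linear.
by rewrite /watts_ract (yoneda_lin (M := representable x')) fmor_linear.
Qed.
Fact watts_ractA y x x' x'' (q : watts_car y x) (f : hom x x')
    (g : hom x' x'') :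
  watts_ract (watts_ract q f) g = watts_ract q (cmp f g).
Proof.
rewrite /watts_ract.
have -> : yoneda (cmp f g : representable x'' x) =
    lhom_comp (yoneda (g : representable x'' x'))
      (yoneda (f : representable x' x)).
  by rewrite yoneda_comp.
by rewrite fmor_comp.
Qed.
Fact watts_ract1 y x (q : watts_car y x) : watts_ract q (idm x) = q.
Proof.
rewrite /watts_ract.
have -> : yoneda (idm x : representable x x) = lhom_id _.
  by apply: lhomP => z f /=; rewrite cmpm1.
by rewrite fmor_id.
Qed.
Fact watts_lractA y' y x x' (g : hom y' y) (q : watts_car y x) (f : hom x x') :
  watts_ract (watts_lact g q) f = watts_lact g (watts_ract q f).
Proof. exact: lfun_act. Qed.

Definition watts : bimod D C :=
  @BiMod k D C watts_car watts_lact watts_ract watts_lact_bilinear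
    watts_lactA watts_lact1 watts_ract_bilinear watts_ractA watts_ract1
    watts_lractA.

End WattsBimodule.

Section Equivalence.
Variables (k : fieldType) (C D : lincat k).
Variables (F : lfunctor C D) (G : lfunctor D C).
Hypothesis GF : nat_iso (lfunctor_comp G F) (lfunctor_id C).
Hypothesis FG : nat_iso (lfunctor_comp F G) (lfunctor_id D).

(** Let L be such that G L is the quotient of G N by the span S of the images
    of the maps G (yoneda n).  By fullness the projection is G g for some
    g : N -> L.  For each n, the map G (g o yoneda n) is zero, so g n = 0 by
    faithfulness; hence the projection is zero and S is everything.  In other
    words the evaluation map P (x) N -> G N is onto. *)
Lemma elements_span (N : leftmod D) x (v : G N x) :
  exists s : seq {y : D & (G (representable y) x * N y)%type},
    v = \sum_(w <- s) fmor G (yoneda (projT2 w).2) x (projT2 w).1.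
Proof.
pose f x (w : {y : D & (G (representable y) x * N y)%type}) : G N x :=
  fmor G (yoneda (projT2 w).2) x (projT2 w).1.
pose S x : set (G N x) := [set v | exists w, v = f x w]%classic.
have S_act x' x'' (h : hom x' x'') m : S x'' m -> S x' (lact h m).
  move=> [[y [p n]] ->]; exists (existT _ y (lact h p, n)).
  by rewrite /f /= lfun_act.
have proj0 : lquo_proj S_act = 0.
  have [s [s_iso s_nat]] := GF; set L := lquo S_act.
  have [s' [_ sK]] := s_iso L.
  have [g Eg] := equivalence_full GF FG (lhom_comp s' (lquo_proj S_act)).
  have g0 : g = 0.
    apply: lhomP => y n.
    suff /lhom_congr /(_ y (idm y)) : lhom_comp g (yoneda n) = 0.
      by rewrite /= lact1.
    apply: (equivalence_faithful FG); rewrite fmor_comp -Eg fmor0.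
    apply: lhomP => z p /=.
    have -> : quo_pi (@S z) (fmor G (yoneda n) z p) = 0 :> L z.
      by apply: quo_pi0; exists (existT _ y (p, n)).
    exact: linear0.
  have -> : lquo_proj S_act = lhom_comp (s L) (lhom_comp s' (lquo_proj S_act)).
    transitivity (lhom_comp (lhom_comp (s L) s') (lquo_proj S_act)).
      by rewrite sK; apply: lhomP.
    exact: lhomP.
  rewrite Eg g0 fmor0; apply: lhomP => z p; exact: linear0.
apply: (lspan_range (f := @f x)).
  move=> a [y [p n]]; exists (existT _ y (a *: p, n)).
  by rewrite /f /= linearZ.
rewrite -[v]subr0; apply/quo_piE; rewrite linear0.
exact: lhom_congr proj0 x v.
Qed.

(** The identity of G N, for N = F(C_x), corresponds to 1 under
    Hom(C_x, G N) = G N x.  Decomposing that element as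
    sum_i G(yoneda n_i)(p_i), the coefficients p_i correspond to maps
    G N = C_x -> G(D_(y_i)), which are of the form G f_i because G is full. *)
Lemma dual_basis x :
  exists s : seq {y : D & (lhom (F (representable x)) (representable y) *
                           F (representable x) y)%type},
    lhom_id (F (representable x)) =
    \sum_(w <- s) lhom_comp (yoneda (projT2 w).2) (projT2 w).1.
Proof.
have [t [t_iso t_nat]] := GF.
set N := F (representable x).
have [t' [t'K tK]] := t_iso (representable x).
have [s Es] := elements_span (t' x (idm x) : G N x).
have lift_p y (p : G (representable y) x) :
    exists g : lhom N (representable y),
      lhom_comp (yoneda p) (t (representable x)) = fmor G g.
  exact: (@equivalence_full _ _ _ _ _ GF FG N (representable y)
    (lhom_comp (yoneda p) (t (representable x)))).
pose dual (w : {y : D & (G (representable y) x * N y)%type}) :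
    {y : D & (lhom N (representable y) * N y)%type} :=
  existT _ (projT1 w) (sval (cid (lift_p _ (projT2 w).1)), (projT2 w).2).
exists (map dual s); apply: (equivalence_faithful FG).
rewrite big_map (linear_fun_sum _ _ (@fmor_linear _ _ _ G N N)) fmor_id.
transitivity (lhom_comp (yoneda (t' x (idm x) : G N x)) (t (representable x))).
  by rewrite (yoneda_id t') t'K.
rewrite Es (linear_fun_sum _ _ (@yoneda_lin _ _ _ _)).
have comp_lin : linear (fun h : lhom (representable x) (G N) =>
    lhom_comp h (t (representable x))).
  by move=> a u v; apply: lhomP.
rewrite (linear_fun_sum _ _ comp_lin); apply: eq_bigr => -[y [p n]] _ /=.
rewrite fmor_comp; case: cid => g /= <-.
by rewrite -yoneda_comp; apply: lhomP.
Qed.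

Section Evaluation.
Variable t : forall M : leftmod C, lhom (G (F M)) M.
Hypothesis t_iso : forall M, lhom_iso (t M).
Hypothesis t_nat : forall M N (f : lhom M N),
  lhom_comp (t N) (fmor G (fmor F f)) = lhom_comp f (t M).

Section Fun.
Variables x' x : C.

Let evL y (q : watts F y x) :
  linear (fun p : watts G x' y =>
    t (representable x) x' (fmor G (yoneda q) x' p)).
Proof.
exact: (linear_compose (lfun_linear _ (x:=x')) (lfun_linear _ (x:=x'))).
Qed.
Let evR y (p : watts G x' y) :
  linear (fun q : watts F y x =>
    t (representable x) x' (fmor G (yoneda q) x' p)).
Proof.
by move=> a q q'; rewrite (yoneda_lin (M := F _)) fmor_linear lfun_linear.
Qed.
Let evB y y' (p : watts G x' y) (g : hom y y') (q : watts F y' x) :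
  t (representable x) x' (fmor G (yoneda q) x' (bract p g)) =
  t (representable x) x' (fmor G (yoneda (blact g q)) x' p).
Proof.
apply: (congr1 (@lfun _ _ _ _ (t (representable x)) x')).
have -> : yoneda (blact g q) =
    lhom_comp (yoneda (q : F (representable x) y'))
      (yoneda (g : representable y' y)).
  by rewrite yoneda_comp.
by rewrite fmor_comp.
Qed.

Definition ev_fun : btens (watts G) (watts F) x' x -> regular C x' x :=
  ltens_lift (N := bcol (watts F) x)
    (fun y (p : watts G x' y) (q : watts F y x) =>
       t (representable x) x' (fmor G (yoneda q) x' p)).

Lemma ev_linear : linear ev_fun.
Proof. exact: (ltens_lift_linear (N := bcol (watts F) x) evL evR evB). Qed.
Lemma ev_pure y (p : watts G x' y) (q : watts F y x) :
  ev_fun (btens_pure p q) = t (representable x) x' (fmor G (yoneda q) x' p).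
Proof. exact: (ltens_lift_pure (N := bcol (watts F) x) evL evR evB). Qed.

End Fun.

Fact ev_lact x'' x' x (f : hom x'' x') (u : btens (watts G) (watts F) x' x) :
  ev_fun (blact f u) = blact f (ev_fun u).
Proof.
move: u; apply: (btens_ext (f := fun u => ev_fun (btens_lact f u))
  (g := fun u => blact f (ev_fun u))).
- exact: linear_compose (@ev_linear x'' x) (btens_lact_linear f).
- exact: linear_compose ((blact_bilinear (regular C) x'' x' x).2 f)
    (@ev_linear x' x).
move=> y p q; rewrite btens_lact_pure !ev_pure.
transitivity (t (representable x) x'' (lact f (fmor G (yoneda q) x' p))).
  apply: (congr1 (@lfun _ _ _ _ (t (representable x)) x'')).
  exact: (lfun_act (fmor G (yoneda q)) f (p : G (representable y) x')).
exact: (lfun_act (t (representable x)) f (fmor G (yoneda q) x' p)).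
Qed.

(** Right multiplication by f is a map of representable modules, so this is
    naturality of t combined with functoriality of G. *)
Fact ev_ract x' x z (u : btens (watts G) (watts F) x' x) (f : hom x z) :
  ev_fun (bract u f) = bract (ev_fun u) f.
Proof.
move: u; apply: (btens_ext (f := fun u => ev_fun (btens_ract u f))
  (g := fun u => bract (ev_fun u) f)).
- exact: linear_compose (@ev_linear x' z)
    (btens_ract_linear (P := watts G) (Q := watts F) f).
- exact: linear_compose ((bract_bilinear (regular C) x' x z).1 f)
    (@ev_linear x' x).
move=> y p q; rewrite btens_ract_pure !ev_pure.
rewrite -[RHS](lhom_congr (t_nat (yoneda (f : representable z x)))) /=.
apply: (congr1 (@lfun _ _ _ _ (t (representable z)) x')).
rewrite -[RHS](lhom_congr (fmor_comp G _ _)).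
by rewrite yoneda_comp.
Qed.

Definition ev : bihom (btens (watts G) (watts F)) (regular C) :=
  BiHom ev_linear ev_lact ev_ract.

(** For the dual basis (f_i, n_i) of F(C_x), the inverse is
    v |-> sum_i G(f_i)(t^-1 v) (x) n_i.  Applied to v = t(G(yoneda q)(p)) it gives
    sum_i p f_i(q) (x) n_i = sum_i p (x) f_i(q) n_i = p (x) q; in the other order,
    sum_i G(yoneda n_i) G(f_i) = G(id). *)
Lemma ev_iso : bimod_iso (btens (watts G) (watts F)) (regular C).
Proof.
have [t' t'K tK] : exists2 t' : forall M, lhom M (G (F M)),
    forall M y, cancel (@lfun _ _ _ _ (t M) y) (@lfun _ _ _ _ (t' M) y) &
    forall M y, cancel (@lfun _ _ _ _ (t' M) y) (@lfun _ _ _ _ (t M) y).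
  by exists (fun M => sval (cid (t_iso M))) => M y v; case: cid => ? [E1 E2];
    [exact: lhom_congr E1 y v | exact: lhom_congr E2 y v].
pose s x := sval (cid (dual_basis x)).
have s_id x : lhom_id _ =
    \sum_(w <- s x) lhom_comp (yoneda (projT2 w).2) (projT2 w).1.
  by rewrite /s; case: cid.
pose g x' x (v : regular C x' x) : btens (watts G) (watts F) x' x :=
  \sum_(w <- s x) btens_pure (P := watts G) (Q := watts F)
     (fmor G (projT2 w).1 x' (t' (representable x) x' v)) (projT2 w).2.
apply: (bimod_isoP (f := ev) (g := g)) => x' x.
  have g_lin : linear (fun u => g x' x (ev_fun u)).
    apply: linear_big => w.
    apply: (linear_compose
      (@btens_pureL _ _ _ _ (watts G) (watts F) x' x _ (projT2 w).2)).
    apply: (linear_compose (g := fun u => t' (representable x) x' (ev_fun u))).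
      exact: lfun_linear.
    exact: (linear_compose (@lfun_linear _ _ _ _ (t' (representable x)) x')
      (@ev_linear x' x)).
  apply: (btens_ext (f := fun u => g x' x (ev_fun u)) (g := id)) => // y p q.
  rewrite ev_pure /g t'K.
  (* The dual basis expands q, and its coefficients move across the tensor. *)
  have Eq : q = \sum_(w <- s x)
      lact ((projT2 w).1 y q : hom y (projT1 w)) (projT2 w).2.
    by rewrite [LHS](lhom_congr (s_id x)) lhom_sumE.
  rewrite [in RHS]Eq.
  rewrite (linear_fun_sum _ _
    (@btens_pureR _ _ _ _ (watts G) (watts F) x' x y p)).
  apply: eq_bigr => w _.
  rewrite -(@btens_balanced _ _ _ _ (watts G) (watts F)); congr btens_pure.
  rewrite -[LHS](lhom_congr (fmor_comp G _ _)).
  by rewrite yoneda_comp.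
move=> v; rewrite /g (linear_fun_sum _ _ (@bfun_linear _ _ _ _ _ ev x' x)).
under eq_bigr => w _ do rewrite /= ev_pure.
rewrite -(linear_fun_sum _ _ (@lfun_linear _ _ _ _ (t (representable x)) x')).
transitivity (t (representable x) x' (t' (representable x) x' v)); last first.
  exact: (tK (representable x) x' v).
apply: (congr1 (@lfun _ _ _ _ (t (representable x)) x')).
move: (t' (representable x) x' v) => w.
have -> : w = fmor G (lhom_id (F (representable x))) x' w by rewrite fmor_id.
rewrite {2}s_id (linear_fun_sum _ _ (@fmor_linear _ _ _ G _ _)) lhom_sumE.
by apply: eq_bigr => i _; rewrite fmor_id fmor_comp.
Qed.

End Evaluation.
End Equivalence.

Lemma watts_tensor_iso (k : fieldType) (C D : lincat k)
    (F : lfunctor C D) (G : lfunctor D C) :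
  nat_iso (lfunctor_comp G F) (lfunctor_id C) ->
  nat_iso (lfunctor_comp F G) (lfunctor_id D) ->
  bimod_iso (btens (watts G) (watts F)) (regular C).
Proof.
by move=> GF FG; have [t [t_iso t_nat]] := GF; exact: (ev_iso GF FG t_iso t_nat).
Qed.

Theorem theorem2p7 (k : fieldType) (C D : lincat k) :
  (morita_equivalent C D <->
   exists (P : bimod C D) (Q : bimod D C),
     bimod_iso (btens P Q) (regular C) /\ bimod_iso (btens Q P) (regular D)) /\
  (forall (P : bimod C D) (Q : bimod D C),
     bimod_iso (btens P Q) (regular C) -> bimod_iso (btens Q P) (regular D) ->
     fg_projective_generators (fun y : D => bcol P y) /\
     fg_projective_generators (fun x : C => bcol Q x)).
Proof.
split=> [|P Q PQ QP]; last first.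
  split; [exact: column_fg_projective_generators PQ QP|].
  exact: column_fg_projective_generators QP PQ.
split=> [[F [G [GF FG]]]|[P [Q [PQ QP]]]]; last exact: tensor_morita PQ QP.
exists (watts G), (watts F).
by split; [exact: watts_tensor_iso GF FG | exact: watts_tensor_iso FG GF].
Qed.
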